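(* There is a constant $C>0$ depending only on $d,g,J$ such that the following holds. Let $\mathbf{u}_0,\mathbf{b}_0\in\mathcal{V}$, assume $\mathbf{u}_0$ lies strictly inside the strength domain and is a critical point of the energy $E[\mathbf{u}]=PD[\mathbf{u}]-\int_\Omega\mathbf{u}\cdot\mathbf{b}_0\,d\mathbf{x}$, i.e. $\mathcal{L}[\mathbf{u}_0]=\mathbf{b}_0$, and assume $\Omega$ satisfies the interior cone condition. Set $$R=\frac{C\,\epsilon^{5/2}}{|||D(\mathcal{L})[\mathbf{u}_0]^{-1}|||}.$$ Then for any continuous load path $\mathbf{b}:[0,T]\to\mathcal{V}$ with $\mathbf{b}(t)\in B\!\left(\mathbf{b}_0,\frac{R}{2|||D(\mathcal{L})[\mathbf{u}_0]^{-1}|||}\right)$ for all $t$, there exists a unique continuous solution path $\mathbf{u}(t)\in\mathcal{V}$ lying inside $B(\mathbf{u}_0,R)$ such that $$\mathcal{L}[\mathbf{u}(t)]=\mathbf{b}(t)\quad\text{for }t\in[0,T].$$ Here $\mathbf{u}_0$ is a critical point and minimizer of $E$: $E[\mathbf{u}]\ge E[\mathbf{u}_0]$ over all displacements $\mathbf{u}$ belonging to the strength domain inside the ball $B(\mathbf{u}_0,R)$.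
   Context: Let $d\in\{2,3\}$ and let $\Omega\subset\mathbb{R}^d$ be a bounded domain (connected open set). Interior cone condition: there are $\lambda>0$, $\theta>0$ such that every $\mathbf{x}\in\Omega$ is the apex of a spherical cone contained in $\Omega$ of radius $\lambda$ and aperture angle $2\theta$ (with axis along some unit vector $\mathbf{e}_{\mathbf{x}}$). Fix $\epsilon>0$ and let $H_\epsilon(\mathbf{x})$ be the ball of radius $\epsilon$ centered at $\mathbf{x}$; $\omega_d$ is the volume of the unit ball of $\mathbb{R}^d$; $\mathbf{e}_{\mathbf{y}-\mathbf{x}}=(\mathbf{y}-\mathbf{x})/|\mathbf{y}-\mathbf{x}|$. $J$ is a non-negative bounded measurable function supported on $[0,1]$, positive on $[0,1)$, and $J^\epsilon(r)=J(r/\epsilon)$. The function $g:\mathbb{R}\to\mathbb{R}$ is three times continuously differentiable, $g,g',g'',g'''$ are bounded, $g(0)=0$, $g(r)>0$ for $r\ne0$, $g$ is convex on $(r^e,r^c)$ with $r^e<0<r^c$ and concave outside this interval, $g''>0$ on $(r^e,r^c)$, $g$ has finite limits at $\pm\infty$, and $\max_r|g''(r)|=g''(0)$. The strain is $S(\mathbf{y},\mathbf{x},\mathbf{u})=\frac{\mathbf{u}(\mathbf{y})-\mathbf{u}(\mathbf{x})}{|\mathbf{y}-\mathbf{x}|}\cdot\mathbf{e}_{\mathbf{y}-\mathbf{x}}$. A displacement $\mathbf{u}$ is in the strength domain if $r^e<\sqrt{|\mathbf{y}-\mathbf{x}|}\,S(\mathbf{y},\mathbf{x},\mathbf{u})<r^c$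 for all $\mathbf{x}\in\Omega$, $\mathbf{y}\in\Omega\cap H_\epsilon(\mathbf{x})$, and strictly inside it if these values all lie in one closed interval contained in $(r^e,r^c)$. The force operator is $$\mathcal{L}[\mathbf{u}](\mathbf{x})=-\int_{H_\epsilon(\mathbf{x})\cap\Omega}\frac{2J^\epsilon(|\mathbf{y}-\mathbf{x}|)}{\epsilon^{d+1}\omega_d\sqrt{|\mathbf{y}-\mathbf{x}|}}\,g'\!\left(\sqrt{|\mathbf{y}-\mathbf{x}|}\,S(\mathbf{y},\mathbf{x},\mathbf{u})\right)\mathbf{e}_{\mathbf{y}-\mathbf{x}}\,d\mathbf{y},$$ its Fréchet derivative is $$D(\mathcal{L})[\mathbf{u}]\Delta\mathbf{u}(\mathbf{x})=-\int_{H_\epsilon(\mathbf{x})\cap\Omega}\frac{2J^\epsilon(|\mathbf{y}-\mathbf{x}|)}{\epsilon^{d+1}\omega_d}\,g''\!\left(\sqrt{|\mathbf{y}-\mathbf{x}|}\,S(\mathbf{y},\mathbf{x},\mathbf{u})\right)S(\mathbf{y},\mathbf{x},\Delta\mathbf{u})\,\mathbf{e}_{\mathbf{y}-\mathbf{x}}\,d\mathbf{y},$$ and the peridynamic energy is $$PD[\mathbf{u}]=\int_\Omega\int_{H_\epsilon(\mathbf{x})\cap\Omega}|\mathbf{y}-\mathbf{x}|\,\mathcal{W}^\epsilon(S(\mathbf{y},\mathbf{x},\mathbf{u}))\,d\mathbf{y}\,d\mathbf{x},\qquad \mathcal{W}^\epsilon(S(\mathbf{y},\mathbf{x},\mathbf{u}))=\frac{J^\epsilon(|\mathbf{y}-\mathbf{x}|)}{\epsilon^{d+1}\omega_d|\mathbf{y}-\mathbf{x}|}\,g\!\left(\sqrt{|\mathbf{y}-\mathbf{x}|}\,S(\mathbf{y},\mathbf{x},\mathbf{u})\right).$$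 Let $\Pi=\{\mathbf{Q}\mathbf{x}+\mathbf{c}:\mathbf{Q}^T=-\mathbf{Q}\in\mathbb{R}^{d\times d},\ \mathbf{c}\in\mathbb{R}^d\}$ and $\mathcal{V}=\{\mathbf{u}\in L^\infty(\Omega;\mathbb{R}^d):\int_\Omega\mathbf{u}\cdot\mathbf{w}\,d\mathbf{x}=0\ \text{for all }\mathbf{w}\in\Pi\}$, with norm $\|\cdot\|_\infty$; $\mathcal{L}$ and $D(\mathcal{L})[\mathbf{u}]$ map $\mathcal{V}$ to $\mathcal{V}$. $B(\hat{\mathbf{u}},R)=\{\mathbf{u}\in L^\infty(\Omega;\mathbb{R}^d):\|\mathbf{u}-\hat{\mathbf{u}}\|_\infty\le R\}$. $|||D(\mathcal{L})[\mathbf{u}]^{-1}|||=\sup_{\mathbf{0}\ne\Delta\mathbf{u}\in\mathcal{V}}\|D(\mathcal{L})[\mathbf{u}]^{-1}\Delta\mathbf{u}\|_\infty/\|\Delta\mathbf{u}\|_\infty$ (in the setting of the claim, $D(\mathcal{L})[\mathbf{u}_0]$ is boundedly invertible on $\mathcal{V}$). Continuity of paths is with respect to $\|\cdot\|_\infty$. *)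

(* Defs.v *)
From HB Require Import structures.
From mathcomp Require Import all_boot all_order all_algebra.
From mathcomp Require Import all_classical all_reals all_analysis.
Set Implicit Arguments.
Unset Strict Implicit.
Unset Printing Implicit Defensive.
Import Order.TTheory GRing.Theory Num.Theory.
Import numFieldNormedType.Exports.
Local Open Scope classical_set_scope.
Local Open Scope ring_scope.

(* Borel sigma-algebra of R^n, generated by the coordinate functions. *)
Section measurable_rV.
Context (R : realType) (n : nat).

Let coors : 'I_n -> 'rV[R]_n -> R := fun i v => v 0 i.

Let rV_set0 : g_sigma_preimage coors set0.
Proof. exact: sigma_algebra0. Qed.

Let rV_setC A : g_sigma_preimage coors A -> g_sigma_preimage coors (~` A).
Proof. exact: sigma_algebraC. Qed.

Let rV_bigcup (F : _^nat) : (forall i, g_sigma_preimage coors (F i)) ->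
  g_sigma_preimage coors (\bigcup_i (F i)).
Proof. exact: sigma_algebra_bigcup. Qed.

HB.instance Definition _ := @isMeasurable.Build default_measure_display
  'rV[R]_n (g_sigma_preimage coors) rV_set0 rV_setC rV_bigcup.

End measurable_rV.

Section rV_theory.
Context (R : realType).

Lemma measurable_coord n (i : 'I_n) :
  measurable_fun [set: 'rV[R]_n] (fun v : 'rV[R]_n => v 0 i).
Proof.
move=> _ Y mY; rewrite setTI; apply: sub_sigma_algebra => /=.
rewrite -bigcup_seq/=; exists i => /=; first by rewrite mem_index_enum.
by exists Y => //; rewrite setTI.
Qed.

Lemma measurable_fun_rVP d (T : measurableType d) n (f : T -> 'rV[R]_n) :
  (forall i, measurable_fun [set: T] (fun x => f x 0 i)) ->
  measurable_fun [set: T] f.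
Proof.
move=> mf.
have : g_sigma_preimage (fun i : 'I_n => (fun v : 'rV[R]_n => v 0 i) \o f)
    `<=` measurable.
  apply: smallest_sub; first exact: sigma_algebra_measurable.
  case: n => [|n] in f mf *; first by rewrite big_ord0.
  rewrite -bigcup_mkord_ord; apply: bigcup_sub => i Ii.
  by move=> A [B mB <-]; exact: mf.
rewrite g_sigma_preimage_comp => prefS.
by move=> _ A mA; apply: prefS; exists A.
Qed.

Definition rV_cons n (p : R * 'rV[R]_n) : 'rV[R]_n.+1 :=
  \row_i oapp (fun j => p.2 0 j) p.1 (unlift ord0 i).

Definition rV_uncons n (v : 'rV[R]_n.+1) : R * 'rV[R]_n :=
  (v 0 ord0, \row_j v 0 (lift ord0 j)).

Lemma rV_consK n : cancel (@rV_cons n) (@rV_uncons n).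
Proof.
move=> [x v]; rewrite /rV_uncons /rV_cons mxE unlift_none; congr pair.
by apply/rowP => j; rewrite !mxE liftK.
Qed.

Lemma measurable_rV_cons n : measurable_fun setT (@rV_cons n).
Proof.
apply: measurable_fun_rVP => i.
under eq_fun do rewrite mxE.
case: unliftP => [j|] _ /=; last exact: measurable_fst.
by apply: (measurableT_comp (measurable_coord j)); exact: measurable_snd.
Qed.

Lemma measurable_rV_uncons n : measurable_fun setT (@rV_uncons n).
Proof.
apply: measurable_fun_pair; first exact: measurable_coord.
apply: measurable_fun_rVP => i.
under eq_fun do rewrite mxE.
exact: measurable_coord.
Qed.

End rV_theory.

Section lebesgue_rV_succ.
Context (R : realType) (n : nat) (m : {sigma_finite_measure set 'rV[R]_n -> \bar R}).

Definition lebesgue_rV_succ : set 'rV[R]_n.+1 -> \bar R :=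
  pushforward (@lebesgue_measure R \x m)%E (@rV_cons R n).

HB.instance Definition _ := Measure.copy lebesgue_rV_succ
  (measure_function_pushforward__canonical__measure_function_Measure
    (@lebesgue_measure R \x m)%E (@measurable_rV_cons R n)).

Let lebesgue_rV_succ_sigma_finite : sigma_finite setT lebesgue_rV_succ.
Proof.
have /sigma_finiteP[F [FT ndF Foo]] := sigma_finiteT (@lebesgue_measure R).
have /sigma_finiteP[G [GT ndG Goo]] := sigma_finiteT m.
exists (fun k => @rV_uncons R n @^-1` (F k `*` G k)).
  rewrite -preimage_bigcup -[LHS](preimage_setT (@rV_uncons R n)).
  congr (_ @^-1` _); apply/esym; rewrite -subTset => -[x v] _.
  have [i _ Fx] : (\bigcup_k F k) x by rewrite -FT.
  have [j _ Gv] : (\bigcup_k G k) v by rewrite -GT.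
  exists (maxn i j) => //; split => /=.
    by move: x Fx; exact/subsetPset/ndF/leq_maxl.
  by move: v Gv; exact/subsetPset/ndG/leq_maxr.
move=> k; have [mF Fk] := Foo k; have [mG Gk] := Goo k.
have mFG : measurable (F k `*` G k) by exact: measurableX.
split; first by rewrite -[X in measurable X]setTI; exact: measurable_rV_uncons.
rewrite /lebesgue_rV_succ /pushforward -comp_preimage.
rewrite (_ : _ \o _ = id) ?preimage_id; last first.
  by apply/funext => p /=; rewrite rV_consK.
by rewrite [ltLHS]product_measure1E// lte_mul_pinfty// ge0_fin_numE.
Qed.

HB.instance Definition _ := Measure_isSigmaFinite.Build _ _ _
  lebesgue_rV_succ lebesgue_rV_succ_sigma_finite.

End lebesgue_rV_succ.

Fixpoint lebesgue_rV (R : realType) (n : nat) :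
    {sigma_finite_measure set 'rV[R]_n -> \bar R} :=
  match n with
  | 0 => @dirac _ 'rV[R]_0 0 R
  | k.+1 => lebesgue_rV_succ (lebesgue_rV R k)
  end.

Lemma lebesgue_rV_box (R : realType) (n : nat) (A : 'I_n -> set R) :
  (forall i, measurable (A i)) ->
  lebesgue_rV R n [set v | forall i, A i (v 0 i)] =
  (\prod_(i < n) @lebesgue_measure R (A i))%E.
Proof.
elim: n A => [|n IHn] A mA.
  by rewrite big_ord0 /= diracE mem_set// => -[].
rewrite big_ord_recl -IHn//= /lebesgue_rV_succ /pushforward.
rewrite -[RHS]product_measure1E; [|exact: mA|]; last first.
  rewrite [X in measurable X](_ : _ = \bigcap_(i in [set: 'I_n])
      (fun v : 'rV[R]_n => v 0 i) @^-1` A (lift ord0 i)).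
    apply: fin_bigcap_measurable => // i _.
    by rewrite -[X in measurable X]setTI; exact: measurable_coord.
  by apply/seteqP; split => v Av i; [move=> _; exact: Av|exact: (Av i)].
congr (product_measure1 _ _ _); apply/seteqP; split => [[x v] /= Axv|[x v] /= [Ax Av] i].
  split; first by have := Axv ord0; rewrite mxE unlift_none.
  by move=> i; have := Axv (lift ord0 i); rewrite mxE liftK.
by rewrite mxE; case: unliftP => [j ->|->] /=; [exact: Av|].
Qed.

Section euclidean.
Context (R : realType) (d : nat).
Implicit Types x y e : 'rV[R]_d.

Definition dotv x y : R := \sum_i x 0 i * y 0 i.

(* The library norm on 'rV[R]_d is the max norm, with the same topology. *)
Definition enorm x : R := Num.sqrt (dotv x x).

Definition eball x (r : R) : set 'rV[R]_d := [set y | enorm (y - x) < r].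

Definition direction y x : 'rV[R]_d := (enorm (y - x))^-1 *: (y - x).

Definition unit_ball_volume : R := fine (lebesgue_rV R d (eball 0 1)).

Definition bounded_domain (Om : set 'rV[R]_d) : Prop :=
  [/\ Om !=set0, open Om, connected Om & bounded_set Om].

Definition spherical_cone x e (lambda theta : R) : set 'rV[R]_d :=
  [set y | enorm (y - x) <= lambda /\
           cos theta * enorm (y - x) <= dotv (y - x) e].

(* theta is the half-angle; for theta > pi the cosine would no longer describe
   a cone, and at theta = pi the cone is the full ball. *)
Definition interior_cone_condition (Om : set 'rV[R]_d) : Prop :=
  exists lambda theta : R, [/\ 0 < lambda, 0 < theta, theta <= pi &
    forall x, Om x ->
      exists e, enorm e = 1 /\ spherical_cone x e lambda theta `<=` Om].

End euclidean.

Section material.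
Context (R : realType).

Record influence_function (J : R -> R) : Prop := InfluenceFunction {
  influence_measurable : measurable_fun [set: R] J;
  influence_bounded : exists M, forall r, J r <= M;
  influence_ge0 : forall r, 0 <= J r;
  influence_support : forall r, ~ (0 <= r <= 1) -> J r = 0;
  influence_gt0 : forall r, 0 <= r < 1 -> 0 < J r }.

Record potential (g : R -> R) (re rc : R) : Prop := Potential {
  potential_derivable : forall n, (n < 3)%N -> forall r, derivable (derive1n n g) r 1;
  potential_C3 : continuous (derive1n 3 g);
  potential_bounded :
    forall n, (n <= 3)%N -> exists M, forall r, `|derive1n n g r| <= M;
  potential0 : g 0 = 0;
  potential_gt0 : forall r, r != 0 -> 0 < g r;
  potential_re : re < 0;
  potential_rc : 0 < rc;
  potential_convex : convex_function (`]re, rc[ : set R^o) g;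
  potential_concave_l : convex_function (`]-oo, re] : set R^o) (fun r => - g r);
  potential_concave_r : convex_function (`[rc, +oo[ : set R^o) (fun r => - g r);
  potential_convex_strict : forall r, re < r < rc -> 0 < derive1n 2 g r;
  potential_cvg_ninfty : cvg (g r @[r --> -oo]);
  potential_cvg_pinfty : cvg (g r @[r --> +oo]);
  potential_max : forall r, `|derive1n 2 g r| <= derive1n 2 g 0 }.

End material.

Section displacements.
Context (R : realType) (d : nat).
Variable Om : set 'rV[R]_d.
Implicit Types u v w : 'rV[R]_d -> 'rV[R]_d.
Local Notation mu := (lebesgue_rV R d).

(* Elements of L^oo(Om; R^d) are represented by functions on R^d, of which only
   the values on Om matter; they are identified when almost everywhere equal. *)
Definition Linf_norm u : \bar R :=
  ('N[mu]_(+oo)[(fun x => (enorm (u x))%:E) \_ Om])%E.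

Definition Linf u : Prop := measurable_fun Om u /\ (Linf_norm u < +oo)%E.

Definition ae_same u v : Prop := {ae mu, forall x, Om x -> u x = v x}.

Definition Linf_ball v (r : R) : set ('rV[R]_d -> 'rV[R]_d) :=
  [set u | Linf u /\ (Linf_norm (u \- v)%R <= r%:E)%E].

Definition rigid : set ('rV[R]_d -> 'rV[R]_d) :=
  [set w | exists (Q : 'M[R]_d) (c : 'rV[R]_d),
    Q^T = - Q /\ w = (fun x => x *m Q^T + c)].

Definition Vspace : set ('rV[R]_d -> 'rV[R]_d) :=
  [set u | Linf u /\
    forall w, rigid w -> \int[mu]_(x in Om) dotv (u x) (w x) = 0].

Definition boundedly_invertible
    (D : ('rV[R]_d -> 'rV[R]_d) -> ('rV[R]_d -> 'rV[R]_d)) : Prop :=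
  [/\ forall f, Vspace f -> exists2 w, Vspace w & ae_same (D w) f,
      forall v w, Vspace v -> Vspace w -> ae_same (D v) (D w) -> ae_same v w &
      exists M : R, forall w, Vspace w -> (Linf_norm w <= M%:E * Linf_norm (D w))%E].

(* With f ranging over the nonzero elements of V, w is the preimage D^-1 f, so
   this is the operator norm of D^-1 when D is boundedly invertible on V. *)
Definition inverse_norm
    (D : ('rV[R]_d -> 'rV[R]_d) -> ('rV[R]_d -> 'rV[R]_d)) : R :=
  sup [set q | exists f w, [/\ Vspace f, ~ ae_same f (cst 0), Vspace w,
    ae_same (D w) f & q = fine (Linf_norm w) / fine (Linf_norm f)]].

Definition continuous_path (T : R) (b : R -> 'rV[R]_d -> 'rV[R]_d) : Prop :=
  forall t, 0 <= t <= T ->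
    Linf_norm (b s \- b t)%R @[s --> within `[0, T] (nbhs t)] --> 0%E.

End displacements.

Section peridynamics.
Context (R : realType) (d : nat).
Variables (J g : R -> R) (Om : set 'rV[R]_d) (eps : R).
Implicit Types u w b : 'rV[R]_d -> 'rV[R]_d.
Implicit Types x y : 'rV[R]_d.
Local Notation mu := (lebesgue_rV R d).
Local Notation omega := (unit_ball_volume R d).

Definition Jeps (r : R) : R := J (r / eps).

Definition strain y x u : R :=
  dotv ((enorm (y - x))^-1 *: (u y - u x)) (direction y x).

Definition scaled_strain y x u : R :=
  Num.sqrt (enorm (y - x)) * strain y x u.

(* L^oo displacements being defined up to null sets, the pointwise conditions
   are required for almost every x and almost every y. *)
Definition strength_domain (re rc : R) u : Prop :=
  {ae mu, forall x, Om x ->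
    {ae mu, forall y, (eball x eps `&` Om) y -> re < scaled_strain y x u < rc}}.

Definition strictly_in_strength_domain (re rc : R) u : Prop :=
  exists a b : R, [/\ re < a, b < rc &
    {ae mu, forall x, Om x ->
      {ae mu, forall y, (eball x eps `&` Om) y ->
        a <= scaled_strain y x u <= b}}].

Definition force u x : 'rV[R]_d :=
  \row_i - \int[mu]_(y in eball x eps `&` Om)
    (2 * Jeps (enorm (y - x))
       / (eps ^+ d.+1 * omega * Num.sqrt (enorm (y - x)))
       * derive1 g (scaled_strain y x u) * direction y x 0 i).

Definition dforce u w x : 'rV[R]_d :=
  \row_i - \int[mu]_(y in eball x eps `&` Om)
    (2 * Jeps (enorm (y - x)) / (eps ^+ d.+1 * omega)
       * derive1n 2 g (scaled_strain y x u) * strain y x w * direction y x 0 i).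

Definition energy_density y x u : R :=
  Jeps (enorm (y - x)) / (eps ^+ d.+1 * omega * enorm (y - x))
    * g (scaled_strain y x u).

Definition PD u : R :=
  \int[mu]_(x in Om) \int[mu]_(y in eball x eps `&` Om)
    (enorm (y - x) * energy_density y x u).

Definition energy b u : R := PD u - \int[mu]_(x in Om) dotv (u x) (b x).

Definition critical_point b u : Prop := ae_same Om (force u) b.

Definition solution_path u0 (r T : R) (b u : R -> 'rV[R]_d -> 'rV[R]_d) : Prop :=
  [/\ forall t, 0 <= t <= T -> Vspace Om (u t) /\ Linf_ball Om u0 r (u t),
      continuous_path Om T u &
      forall t, 0 <= t <= T -> ae_same Om (force (u t)) (b t)].

End peridynamics.

(* Main.v *)
Require Import Defs.
From HB Require Import structures.
From mathcomp Require Import all_boot all_order all_algebra.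
From mathcomp Require Import all_classical all_reals all_analysis.
From mathcomp Require Import measurable_realfun ess_sup_inf.
From mathcomp Require Import ring lra.
Import Order.TTheory GRing.Theory Num.Theory.
Import numFieldNormedType.Exports.
Set Implicit Arguments.
Unset Strict Implicit.
Unset Printing Implicit Defensive.
Local Open Scope classical_set_scope.
Local Open Scope ring_scope.

(** The force operator F is differentiable and its derivative is Lipschitz for
    the essential supremum norm. Indeed the force of a bond of length r
    depends on u through g' (sqrt r * strain), a difference of displacements
    of size c changes sqrt r * strain by at most 2 c / sqrt r, and the factor
    in front is of order r^(-1/2); the second order Taylor remainder is thus
    of order r^(-3/2), which is integrable in dimension 2 and more
    [integral_singular_kernel]. Integrating over the ball of radius eps gives
    a Lipschitz constant of order eps^(-5/2) [force_approx]. With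
    A the derivative at u0 and N the norm of its inverse on the fields
    orthogonal to rigid motions, the radius rad = C eps^(5/2) / N is the one
    for which F - A contracts by 1 / (2 N) on the ball of radius rad.

    Everything about the load path follows from this. Any two fields u, v of
    the ball satisfy |u - v| <= 2 N |F u - F v| [newton_stability], which gives
    uniqueness and, along the path, continuity: the solution moves at most
    2 N times as fast as the load. Existence at each time is a Newton
    iteration with the derivative taken at u0 throughout [newton_solution]:
    as the load is at distance at most rad / (2 N) from F u0, the first step
    has size at most rad / 2, the following ones are halved each time, and the
    iterates stay in the ball; their limit exists by completeness
    [Vspace_complete]. The iteration stays within the fields orthogonal to
    rigid motions because a symmetric bond density exerts no total force and
    no total torque [bond_op_rigid].

    Minimality is a convexity argument. In the strength domain the strain of
    every bond stays where g is convex, so the energy of u exceeds that of u0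
    by at least the work, in the displacement u - u0, of the force field of
    u0 minus the load [critical_point_minimizes], and this work is 0 since u0
    is critical. The work is computed by Fubini's theorem and the symmetry of
    bonds [bond_op_weak].

    Fields are only defined up to null sets. Before any estimate they are
    restricted to a measurable subset of full measure on which the almost
    everywhere bounds hold everywhere [ae_full_set], and extended by 0. *)

(** * The Euclidean norm on row vectors *)

Section euclidean_norm.
Context (R : realType) (d : nat).
Implicit Types x y z e : 'rV[R]_d.

Lemma dotvC x y : dotv x y = dotv y x.
Proof. by apply: eq_bigr => i _; rewrite mulrC. Qed.

Lemma dotvDl x y z : dotv (x + y) z = dotv x z + dotv y z.
Proof. by rewrite -big_split; apply: eq_bigr => i _; rewrite mxE mulrDl. Qed.

Lemma dotvDr x y z : dotv z (x + y) = dotv z x + dotv z y.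
Proof. by rewrite dotvC dotvDl !(dotvC _ z). Qed.

Lemma dotvZl (c : R) x y : dotv (c *: x) y = c * dotv x y.
Proof. by rewrite mulr_sumr; apply: eq_bigr => i _; rewrite mxE mulrA. Qed.

Lemma dotvZr (c : R) x y : dotv x (c *: y) = c * dotv x y.
Proof. by rewrite dotvC dotvZl dotvC. Qed.

Lemma dotvNl x y : dotv (- x) y = - dotv x y.
Proof. by rewrite -scaleN1r dotvZl mulN1r. Qed.

Lemma dotvNr x y : dotv x (- y) = - dotv x y.
Proof. by rewrite dotvC dotvNl dotvC. Qed.

Lemma dotvBl x y z : dotv (x - y) z = dotv x z - dotv y z.
Proof. by rewrite dotvDl dotvNl. Qed.

Lemma dotvBr x y z : dotv z (x - y) = dotv z x - dotv z y.
Proof. by rewrite dotvDr dotvNr. Qed.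

Lemma dotv0l x : dotv 0 x = 0.
Proof. by rewrite /dotv big1// => i _; rewrite mxE mul0r. Qed.

Lemma dotvv_ge0 x : 0 <= dotv x x.
Proof. by apply: sumr_ge0 => i _; rewrite -expr2 sqr_ge0. Qed.

Lemma enorm_ge0 x : 0 <= enorm x. Proof. exact: sqrtr_ge0. Qed.
Hint Resolve enorm_ge0 : core.

Lemma enorm_sqr x : enorm x ^+ 2 = dotv x x.
Proof. by rewrite sqr_sqrtr// dotvv_ge0. Qed.

Lemma enorm0 : enorm (0 : 'rV[R]_d) = 0.
Proof. by rewrite /enorm dotv0l sqrtr0. Qed.

Lemma enormN x : enorm (- x) = enorm x.
Proof. by rewrite /enorm dotvNl dotvNr opprK. Qed.

Lemma enormB x y : enorm (x - y) = enorm (y - x).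
Proof. by rewrite -enormN opprB. Qed.

Lemma enormZ (c : R) x : enorm (c *: x) = `|c| * enorm x.
Proof.
rewrite /enorm dotvZl dotvZr mulrA -expr2 sqrtrM ?sqr_ge0//.
by rewrite sqrtr_sqr.
Qed.

Lemma coord_le_enorm x i : `|x 0 i| <= enorm x.
Proof.
rewrite -sqrtr_sqr ler_wsqrtr// /dotv (bigD1 i)//= -expr2 lerDl.
by apply: sumr_ge0 => j _; rewrite -expr2 sqr_ge0.
Qed.

Lemma enorm_eq0 x : enorm x = 0 -> x = 0.
Proof.
move=> x0; apply/rowP => i; rewrite mxE; apply/eqP; rewrite -normr_le0 -x0.
exact: coord_le_enorm.
Qed.

(** The squared norm of (y.y) x - (x.y) y equals (y.y) times the Gram
    determinant of x and y, which is therefore nonnegative. *)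
Lemma cauchy_schwarz x y : `|dotv x y| <= enorm x * enorm y.
Proof.
have [y0|y0] := eqVneq (enorm y) 0.
  by rewrite (enorm_eq0 y0) dotvC dotv0l normr0 mulr_ge0.
have n0 : 0 < dotv y y by rewrite -enorm_sqr exprn_gt0// lt_neqAle eq_sym y0 /=.
have := dotvv_ge0 (dotv y y *: x - dotv x y *: y).
rewrite !(dotvBl,dotvBr,dotvZl,dotvZr) (dotvC y x) => h.
have {}h : 0 <= dotv y y * (dotv x x * dotv y y - dotv x y ^+ 2).
  by apply: le_trans h _; rewrite le_eqVlt; apply/orP; left; apply/eqP; ring.
rewrite pmulr_rge0// subr_ge0 in h.
by rewrite -sqrtr_sqr -sqrtrM ?dotvv_ge0// ler_wsqrtr.
Qed.

Lemma enormD x y : enorm (x + y) <= enorm x + enorm y.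
Proof.
rewrite -(@ler_pXn2r _ 2)// ?nnegrE ?addr_ge0//.
rewrite sqrrD !enorm_sqr dotvDl !dotvDr (dotvC y x).
have := le_trans (ler_norm _) (cauchy_schwarz x y); lra.
Qed.

Lemma enorm_le_sum x : enorm x <= \sum_i `|x 0 i|.
Proof.
have s0 : 0 <= \sum_i `|x 0 i| by exact: sumr_ge0.
rewrite -(@ler_pXn2r _ 2)// ?nnegrE// enorm_sqr expr2 mulr_suml.
apply: ler_sum => i _; apply: le_trans (ler_norm _) _; rewrite normrM.
by rewrite ler_wpM2l// (bigD1 i)//= lerDl sumr_ge0.
Qed.

Lemma enorm_le_coord x c : (forall i, `|x 0 i| <= c) -> enorm x <= d%:R * c.
Proof.
move=> xc; apply: le_trans (enorm_le_sum _) _.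
apply: le_trans (ler_sum _ (fun i _ => xc i)) _.
by rewrite sumr_const card_ord mulr_natl.
Qed.

Lemma direction_coord_le1 x y i : `|direction y x 0 i| <= 1.
Proof.
rewrite mxE normrM normfV (ger0_norm (enorm_ge0 _)).
have [->|n0] := eqVneq (enorm (y - x)) 0; first by rewrite invr0 mul0r.
by rewrite mulrC ler_pdivrMr ?mul1r ?coord_le_enorm// lt_neqAle eq_sym n0 /=.
Qed.

Lemma enorm_direction_le1 x y : enorm (direction y x) <= 1.
Proof.
rewrite enormZ normfV (ger0_norm (enorm_ge0 _)).
have [->|n0] := eqVneq (enorm (y - x)) 0; first by rewrite invr0 mul0r.
by rewrite mulVf.
Qed.

Lemma directionC x y : direction y x = - direction x y.
Proof. by rewrite /direction enormB -scalerN opprB. Qed.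

End euclidean_norm.
#[global] Hint Extern 0 (is_true (0 <= enorm _)) => solve [apply: enorm_ge0] : core.

(** * Measurability and volume of subsets of the Euclidean space *)

Section measurability.
Context (R : realType) (d : nat).
Local Notation mu := (lebesgue_rV R d).

(** The inverse is a real power on the nonnegative reals, also at 0, where
    both are 0; this bypasses the discontinuity of the inverse. *)
Lemma measurable_invr_ge0 disp (T : measurableType disp) (f : T -> R) :
  (forall x, 0 <= f x) -> measurable_fun setT f ->
  measurable_fun setT (fun x => (f x)^-1).
Proof.
move=> f0 mf; under eq_fun do rewrite -powR_inv1//.
exact: (measurableT_comp (measurable_powR _)).
Qed.

Lemma measurable_sqrtr disp (T : measurableType disp) (f : T -> R) :
  measurable_fun setT f -> measurable_fun setT (fun x => Num.sqrt (f x)).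
Proof.
move=> mf; apply: (measurableT_comp _ mf).
apply: continuous_measurable_fun; exact: sqrt_continuous.
Qed.

Section vectors.
Context disp (T : measurableType disp).
Implicit Types (u v : T -> 'rV[R]_d) (c : T -> R).

Lemma measurable_coordT u i :
  measurable_fun setT u -> measurable_fun setT (fun t => u t 0 i).
Proof. by move=> mu_; exact: (measurableT_comp (measurable_coord i) mu_). Qed.

Lemma measurable_addv u v : measurable_fun setT u -> measurable_fun setT v ->
  measurable_fun setT (fun t => u t + v t).
Proof.
move=> mu_ mv; apply: measurable_fun_rVP => i; under eq_fun do rewrite mxE.
by apply: measurable_funD; exact: measurable_coordT.
Qed.

Lemma measurable_scalev c u : measurable_fun setT c -> measurable_fun setT u ->
  measurable_fun setT (fun t => c t *: u t).
Proof.
move=> mc mu_; apply: measurable_fun_rVP => i; under eq_fun do rewrite mxE.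
by apply: measurable_funM => //; exact: measurable_coordT.
Qed.

Lemma measurable_oppv u : measurable_fun setT u ->
  measurable_fun setT (fun t => - u t).
Proof.
move=> mu_; apply: measurable_fun_rVP => i; under eq_fun do rewrite mxE.
by apply: measurable_funN; exact: measurable_coordT.
Qed.

Lemma measurable_subv u v : measurable_fun setT u -> measurable_fun setT v ->
  measurable_fun setT (fun t => u t - v t).
Proof. by move=> mu_ mv; apply: measurable_addv => //; exact: measurable_oppv. Qed.

Lemma measurable_dotv u v : measurable_fun setT u -> measurable_fun setT v ->
  measurable_fun setT (fun t => dotv (u t) (v t)).
Proof.
move=> mu_ mv; apply: measurable_sum => i.
by apply: measurable_funM; exact: measurable_coordT.
Qed.

Lemma measurable_enorm u : measurable_fun setT u ->
  measurable_fun setT (fun t => enorm (u t)).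
Proof. by move=> mu_; apply/measurable_sqrtr/measurable_dotv. Qed.

Lemma measurable_direction u v :
  measurable_fun setT u -> measurable_fun setT v ->
  measurable_fun setT (fun t => direction (v t) (u t)).
Proof.
move=> mu_ mv; have mvu := measurable_subv mv mu_.
apply: measurable_scalev => //.
by apply: measurable_invr_ge0 => //; exact: measurable_enorm.
Qed.

End vectors.

(** The sigma-algebra is generated by the coordinates, so that rational cubes
    are measurable, and an open set is the countable union of the rational
    cubes that it contains. *)
Lemma open_measurable_rV (A : set 'rV[R]_d) : open A -> measurable A.
Proof.
move=> oA.
pose box (q : 'rV[rat]_d * nat) : set 'rV[R]_d :=
  [set v | forall i, `|ratr (q.1 0 i) - v 0 i| < q.2.+1%:R^-1].
have mbox q : measurable (box q).
  rewrite [X in measurable X](_ : _ = \bigcap_(i in [set: 'I_d])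
      (fun v : 'rV[R]_d => v 0 i) @^-1`
        ball (ratr (q.1 0 i) : R) (q.2.+1%:R^-1 : R)).
    apply: fin_bigcap_measurable => // i _.
    rewrite -[X in measurable X]setTI; apply: measurable_coord => //.
    exact: measurable_ball.
  by apply/seteqP; split => v Av i; [move=> _; exact: Av|exact: (Av i)].
rewrite (_ : A = \bigcup_(q in [set q | box q `<=` A]) box q).
  rewrite bigcup_mkcond; apply: countable_bigcupT_measurable => // q.
  by case: ifPn.
apply/seteqP; split; last by move=> v [q qA /qA].
move=> v Av.
have /nbhs_ballP[e /= e0 ve] : nbhs v A by exact: open_nbhs_nbhs.
have e20 : 0 < e / 2 by rewrite divr_gt0.
have [k _ /(_ k (leqnn k)) /= ke] := near_infty_natSinv_lt (PosNum e20).
have k0 : (0 : R) < k.+1%:R^-1 by rewrite invr_gt0.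
have /choice[q qv] i : exists q : rat, `|ratr q - v 0 i| < k.+1%:R^-1.
  have : v 0 i - k.+1%:R^-1 < v 0 i + k.+1%:R^-1.
    by rewrite ltrBlDr -addrA ltrDl addr_gt0.
  move=> /rat_in_itvoo[q]; rewrite in_itv/= => qv; exists q.
  by rewrite ltr_distl.
exists (\row_i q i, k) => [w /= wq|i /=]; last by rewrite mxE.
apply: ve; split=> // i j; rewrite !ord1.
have := wq j; rewrite /= mxE => qw.
apply: le_lt_trans (ler_distD (ratr (q j)) _ _) _.
by rewrite [ltRHS]splitr ltrD// ?(distrC (v 0 j))//; apply: lt_trans ke.
Qed.

Definition cube (x : 'rV[R]_d) (r : R) : set 'rV[R]_d :=
  [set v | forall i, `[x 0 i - r, x 0 i + r]%classic (v 0 i)].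

Lemma measurable_cube x r : measurable (cube x r).
Proof.
rewrite [X in measurable X](_ : _ = \bigcap_(i in [set: 'I_d])
    (fun v : 'rV[R]_d => v 0 i) @^-1` `[x 0 i - r, x 0 i + r]%classic).
  apply: fin_bigcap_measurable => // i _.
  by rewrite -[X in measurable X]setTI; apply: measurable_coord.
by apply/seteqP; split => v Av i; [move=> _; exact: Av|exact: (Av i)].
Qed.

Lemma lebesgue_rV_cube x r : 0 <= r -> mu (cube x r) = (((2 * r) ^+ d)%:E)%E.
Proof.
move=> r0.
rewrite (lebesgue_rV_box (A := fun i => `[x 0 i - r, x 0 i + r]%classic))//.
under eq_bigr do rewrite lebesgue_measure_itv/=.
rewrite (eq_bigr (fun=> (2 * r)%:E)) => [|i _].
  by rewrite prodEFin prodr_const card_ord.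
rewrite lte_fin; case: ltP => [_|h].
  by rewrite -EFinB; congr EFin; ring.
have -> : r = 0 by apply/eqP; rewrite eq_le r0 andbT; lra.
by rewrite mulr0.
Qed.

Lemma bounded_set_coord (A : set 'rV[R]_d) : bounded_set A ->
  exists2 M : R, 0 <= M & A `<=` cube 0 M.
Proof.
move=> [M [Mr MA]]; exists (`|M| + 1) => [|x Ax i /=]; first by rewrite addr_ge0.
have := MA (`|M| + 1); rewrite ltr_pwDr ?ler_norm// => /(_ erefl x Ax) xM.
rewrite mxE in_itv/= sub0r add0r -ler_norml; apply: le_trans xM.
rewrite [leRHS]/Num.norm/= mx_normrE.
by apply/bigmax_geP; right => /=; exists (0, i).
Qed.

Lemma bounded_set_fin_measure (A : set 'rV[R]_d) : measurable A ->
  bounded_set A -> (mu A < +oo)%E.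
Proof.
move=> mA /bounded_set_coord[M M0 AM].
apply: (@le_lt_trans _ _ (mu (cube 0 M))); last by rewrite lebesgue_rV_cube// ltry.
by rewrite le_measure ?inE//; exact: measurable_cube.
Qed.

Lemma lebesgue_rV_setT_gt0 : (0 < mu setT)%E.
Proof.
apply: (@lt_le_trans _ _ (mu (cube 0 1))).
  by rewrite lebesgue_rV_cube// lte_fin exprn_gt0// mulr_gt0.
by rewrite le_measure ?inE//; exact: measurable_cube.
Qed.

End measurability.

(** * The kernel |y - x|^(-3/2) on a ball *)

Section singular_kernel.
Context (R : realType) (d : nat) (eps : R).
Hypotheses (d2 : (2 <= d)%N) (eps0 : 0 < eps).
Local Notation mu := (lebesgue_rV R d).
Implicit Types x y : 'rV[R]_d.

(** The power -3/2 of the distance, written as an inverse times an inverse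
    square root. As the inverse of 0 is 0, the kernel vanishes on the
    diagonal. *)
Definition singular_kernel x y : R :=
  if enorm (y - x) < eps
  then (enorm (y - x))^-1 * (Num.sqrt (enorm (y - x)))^-1 else 0.

(** A bound for the integral of the singular kernel, of the order eps^(d -
    3/2) that scaling predicts. *)
Definition singular_mass : R :=
  16 * 2 ^+ d * eps ^+ d / (eps * Num.sqrt eps).

Lemma singular_kernel_ge0 x y : 0 <= singular_kernel x y.
Proof.
rewrite /singular_kernel; case: ifPn => // _.
by rewrite mulr_ge0 ?invr_ge0 ?sqrtr_ge0.
Qed.

Lemma singular_kernelC x y : singular_kernel x y = singular_kernel y x.
Proof. by rewrite /singular_kernel enormB. Qed.

Lemma measurable_singular_kernel :
  measurable_fun setT (fun z : 'rV[R]_d * 'rV[R]_d => singular_kernel z.1 z.2).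
Proof.
have mr : measurable_fun setT
    (fun z : 'rV[R]_d * 'rV[R]_d => enorm (z.2 - z.1)).
  by apply: measurable_enorm; exact: measurable_subv.
apply: measurable_fun_ifT => //; first exact: measurable_fun_ltr.
apply: measurable_funM; first exact: measurable_invr_ge0.
apply: measurable_invr_ge0; first by move=> z; rewrite sqrtr_ge0.
exact: measurable_sqrtr.
Qed.

(* Shells of ratio 4 keep the square roots rational: hgt k is the value of the
   kernel on the inner sphere, of radius rad k.+1, of the k-th shell. *)
Let rad k : R := eps / 4 ^+ k.
Let hgt k : R := 8 ^+ k.+1 / (eps * Num.sqrt eps).

Let rad_gt0 k : 0 < rad k.
Proof. by rewrite divr_gt0// exprn_gt0. Qed.

Let hgt_ge0 k : 0 <= hgt k.
Proof. by rewrite divr_ge0 ?exprn_ge0// mulr_ge0 ?sqrtr_ge0// ltW. Qed.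

Let hgtE k : (rad k.+1)^-1 * (Num.sqrt (rad k.+1))^-1 = hgt k.
Proof.
have s4 : Num.sqrt (4 ^+ k.+1 : R) = 2 ^+ k.+1.
  rewrite (_ : 4 = 2 ^+ 2 :> R); last by rewrite expr2; lra.
  by rewrite exprAC sqrtr_sqr ger0_norm// exprn_ge0.
rewrite /rad sqrtrM ?ltW// sqrtrV ?exprn_ge0// s4 /hgt.
have -> : 8 ^+ k.+1 = 4 ^+ k.+1 * 2 ^+ k.+1 :> R.
  by rewrite -exprMn; congr (_ ^+ _); lra.
by rewrite !invfM !invrK; ring.
Qed.

Let shell (r : R) : 0 < r < eps -> exists k, rad k.+1 <= r <= rad k.
Proof.
move=> /andP[r0 re].
have rk_cvg : exists k, rad k.+1 <= r.
  have [n _ /(_ n (leqnn n)) /= nr] :=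
    near_infty_natSinv_lt (PosNum (divr_gt0 r0 eps0)).
  exists n; apply: (@le_trans _ _ (eps * n.+1%:R^-1)).
    rewrite ler_wpM2l ?(ltW eps0)// lef_pV2 ?posrE ?exprn_gt0//.
    by rewrite -natrX ler_nat ltnW// ltn_expl.
  by rewrite mulrC -ler_pdivlMr// ltW.
case: (ex_minnP rk_cvg) => -[|k] kr kmin.
  by exists 0%N; rewrite kr /rad expr0 divr1 ltW.
exists k.+1; rewrite kr leNgt; apply/negP => /ltW /kmin; by rewrite ltnn.
Qed.

Let singular_kernel_le_shells x y :
  ((singular_kernel x y)%:E <=
    \sum_(k <oo) (hgt k * \1_(cube x (rad k)) y)%:E)%E.
Proof.
have t0 k : (0 <= (hgt k * \1_(cube x (rad k)) y)%:E)%E.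
  by rewrite lee_fin mulr_ge0.
rewrite /singular_kernel; case: ifPn => re; last exact: nneseries_ge0.
have [r0|r0] := eqVneq (enorm (y - x)) 0.
  by rewrite r0 invr0 mul0r; exact: nneseries_ge0.
have {}r0 : 0 < enorm (y - x) by rewrite lt0r r0 enorm_ge0.
have r0e : 0 < enorm (y - x) < eps by rewrite r0.
have [k /andP[kr rk]] := shell r0e.
apply: (le_trans _ (nneseries_lim_ge k.+1 _)) => //.
rewrite big_mkord big_ord_recr/= -[leLHS]add0e; apply: leeD.
  by apply: sume_ge0 => i _; exact: t0.
rewrite lee_fin indicE mem_set ?mulr1; last first.
  move=> i /=; rewrite in_itv/= -ler_distlC.
  have := coord_le_enorm (y - x) i; rewrite !mxE distrC => h.
  exact: le_trans h rk.
rewrite -hgtE ler_pM ?invr_ge0 ?sqrtr_ge0//.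
  by rewrite lef_pV2 ?posrE.
by rewrite lef_pV2 ?ler_wsqrtr// posrE sqrtr_gt0.
Qed.

Let shell_mass k :
  hgt k * (2 * rad k) ^+ d <= singular_mass / 2 * 2^-1 ^+ k.
Proof.
have e3 : 0 < eps * Num.sqrt eps by rewrite mulr_gt0// sqrtr_gt0.
rewrite /hgt /rad /singular_mass !exprMn !exprVn.
rewrite [leLHS](_ : _ = (2 ^+ d * eps ^+ d / (eps * Num.sqrt eps)) *
  (8 ^+ k.+1 * ((4 ^+ k) ^+ d)^-1)); last by ring.
rewrite [leRHS](_ : _ = (2 ^+ d * eps ^+ d / (eps * Num.sqrt eps)) *
  (8 * (2 ^+ k)^-1)); last first.
  by field; rewrite !gt_eqF ?exprn_gt0 ?sqrtr_gt0.
rewrite ler_wpM2l ?divr_ge0 ?mulr_ge0 ?exprn_ge0 ?(ltW eps0) ?(ltW e3)//.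
rewrite exprS -mulrA ler_wpM2l// ler_pdivrMr ?exprn_gt0// mulrC.
rewrite ler_pdivlMr ?exprn_gt0// -!exprMn.
rewrite (_ : 8 * 2 = 4 ^+ 2 :> R); last by rewrite expr2; lra.
by rewrite -!exprM ler_weXn2l ?ler1n// mulnC leq_mul2l d2 orbT.
Qed.

(** The ball is cut into the shells between the radii eps / 4^k and eps /
    4^k.+1. On the k-th shell the kernel is at most 8^k.+1 / eps^(3/2), and
    the shell lies in a cube of volume (2 eps / 4^k)^d. Since d >= 2, these
    masses decay at least like 2^-k, and they sum to singular_mass. *)
Lemma integral_singular_kernel x :
  (\int[mu]_y (singular_kernel x y)%:E <= singular_mass%:E)%E.
Proof.
have t0 k y : (0 <= (hgt k * \1_(cube x (rad k)) y)%:E)%E.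
  by rewrite lee_fin mulr_ge0.
have mt k : measurable_fun setT
    (fun y => (hgt k * \1_(cube x (rad k)) y)%:E).
  apply/measurable_EFinP/measurable_funM => //.
  by apply: measurable_indic; exact: measurable_cube.
apply: (@le_trans _ _ (\int[mu]_y
    \sum_(k <oo) (hgt k * \1_(cube x (rad k)) y)%:E)%E).
  apply: ge0_le_integral => //=.
  - by move=> y _; rewrite lee_fin singular_kernel_ge0.
  - apply/measurable_EFinP.
    exact: (measurable_fun_pair2 x measurable_singular_kernel).
  - by apply: ge0_emeasurable_sum.
rewrite integral_nneseries//.
rewrite (@eq_eseriesr _ _ (fun k => (hgt k * (2 * rad k) ^+ d)%:E)); last first.
  move=> k _; under eq_integral do rewrite EFinM.
  rewrite ge0_integralZl//; last 2 first.
  - by apply/measurable_EFinP/measurable_indic; exact: measurable_cube.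
  - by rewrite lee_fin.
  rewrite integral_indic ?setIT//; last exact: measurable_cube.
  by have /= -> := lebesgue_rV_cube x (ltW (rad_gt0 k)).
apply: lime_le.
  apply: is_cvg_nneseries => k _ _; rewrite lee_fin mulr_ge0//.
  by rewrite exprn_ge0// mulr_ge0// ltW.
apply: nearW => n; rewrite sumEFin lee_fin.
apply: le_trans (ler_sum _ (fun k _ => shell_mass k)) _.
rewrite -mulr_sumr.
have s0 : 0 <= singular_mass / 2.
  by rewrite !divr_ge0 ?mulr_ge0 ?exprn_ge0 ?sqrtr_ge0// ltW.
rewrite [leRHS](_ : _ = singular_mass / 2 * 2); last by field.
rewrite ler_wpM2l//.
rewrite big_mkord.
have := subrX1 (2^-1 : R) n; set S := \sum_(i < n) _ => h.
have : 0 <= 2^-1 ^+ n :> R by rewrite exprn_ge0.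
lra.
Qed.

End singular_kernel.

(** * Integrals of kernels dominated by the singular kernel *)

Section Rintegral_complements.
Context disp (T : measurableType disp) (R : realType).
Variable nu : {measure set T -> \bar R}.

Lemma Rintegral_sum (D : set T) (I : Type) (s : seq I) (f : I -> T -> R) :
  measurable D -> (forall i, nu.-integrable D (EFin \o f i)) ->
  \int[nu]_(x in D) (\sum_(i <- s) f i x) =
  \sum_(i <- s) \int[nu]_(x in D) f i x.
Proof.
move=> mD intf.
have ints r : nu.-integrable D (EFin \o (fun x => \sum_(i <- r) f i x)).
  elim: r => [|i r ih].
    by under [X in EFin \o X]eq_fun do rewrite big_nil; exact: integrable0.
  under [X in EFin \o X]eq_fun do rewrite big_cons.
  exact: (integrableD mD (intf i) ih).
elim: s => [|i s ih].
  rewrite big_nil; under eq_Rintegral do rewrite big_nil.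
  by rewrite Rintegral_cst// mul0r.
rewrite big_cons -ih -RintegralD//; apply: eq_Rintegral => x _.
by rewrite big_cons.
Qed.

(** Replacing the domain by an indicator function lets Fubini's theorem be
    applied on the whole space. *)
Lemma integral_indicE (D : set T) (f : T -> R) :
  (\int[nu]_(x in D) (f x)%:E = \int[nu]_x (f x * \1_D x)%:E)%E.
Proof.
rewrite integral_mkcond; apply: eq_integral => x _.
by rewrite patchE indicE; case: ifPn; rewrite ?mulr1 ?mulr0.
Qed.

End Rintegral_complements.

Section dominated_kernels.
Context (R : realType) (d : nat) (eps : R) (Om : set 'rV[R]_d).
Hypotheses (d2 : (2 <= d)%N) (eps0 : 0 < eps).
Hypotheses (mOm : measurable Om) (finOm : (lebesgue_rV R d Om < +oo)%E).
Local Notation mu := (lebesgue_rV R d).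
Local Notation kernel := (singular_kernel eps).
Local Notation mass := (singular_mass d eps).
Implicit Types (x y : 'rV[R]_d) (k : 'rV[R]_d -> 'rV[R]_d -> R) (c : R).

Definition joint_measurable k :=
  measurable_fun setT (fun z : 'rV[R]_d * 'rV[R]_d => k z.1 z.2).

(** Domination by a multiple of the singular kernel is what every integrand of
    the theory satisfies: it makes the integral over y bounded uniformly in x,
    hence the kernel integrable on a set of finite measure times the space. *)
Definition dominated c k :=
  joint_measurable k /\ forall x y, `|k x y| <= c * kernel x y.

Lemma joint_measurable_section k x : joint_measurable k ->
  measurable_fun setT (k x).
Proof. by move=> mk; exact: (measurable_fun_pair2 x mk). Qed.

Lemma joint_measurable_swap k : joint_measurable k ->
  joint_measurable (fun x y => k y x).
Proof. by move=> mk; exact: (measurableT_comp mk (@measurable_swap _ _ _ _)). Qed.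

Lemma measurable_singular_section x :
  measurable_fun setT (fun y => (kernel x y)%:E).
Proof.
apply/measurable_EFinP.
exact: (measurable_fun_pair2 x (@measurable_singular_kernel R d eps)).
Qed.

Lemma integrable_singular_kernel x :
  mu.-integrable setT (fun y => (kernel x y)%:E).
Proof.
apply/integrableP; split.
  exact: measurable_singular_section.
apply: (@le_lt_trans _ _ mass%:E); last exact: ltry.
apply: le_trans (integral_singular_kernel d2 eps0 x).
rewrite le_eqVlt; apply/orP; left; apply/eqP; apply: eq_integral => y _.
by rewrite /= ger0_norm ?singular_kernel_ge0.
Qed.

Lemma dominated_swap c k : dominated c k -> dominated c (fun x y => k y x).
Proof.
move=> [mk kc]; split; first exact: joint_measurable_swap.
by move=> x y; rewrite singular_kernelC.
Qed.

Lemma dominatedZ a c k : 0 <= a -> dominated c k ->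
  dominated (a * c) (fun x y => a * k x y).
Proof.
move=> a0 [mk kc]; split; first exact: measurable_funM.
by move=> x y; rewrite normrM ger0_norm// -mulrA ler_wpM2l.
Qed.

Lemma dominated_integrableT c k x : dominated c k ->
  mu.-integrable setT (fun y => (k x y)%:E).
Proof.
move=> [mk kc]; apply: (@le_integrable _ _ _ _ _ _ _
    (fun y => c%:E * (kernel x y)%:E)%E) => //.
- by apply/measurable_EFinP; exact: joint_measurable_section.
- move=> y _; rewrite -EFinM /= lee_fin.
  exact: le_trans (kc x y) (ler_norm _).
- by apply: integrableZl => //; exact: integrable_singular_kernel.
Qed.

Lemma dominated_integrable c k x : dominated c k ->
  mu.-integrable Om (EFin \o k x).
Proof.
by move=> ck; apply: (integrableS measurableT) => //;
  exact: (dominated_integrableT x ck).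
Qed.

Lemma dominated_integral_norm c k x : 0 <= c -> dominated c k ->
  (\int[mu]_y `|(k x y)%:E| <= (c * mass)%:E)%E.
Proof.
move=> c0 [mk kc]; apply: (@le_trans _ _ (\int[mu]_y (c%:E * (kernel x y)%:E))%E).
  apply: ge0_le_integral => //.
  - apply/measurableT_comp => //.
    by apply/measurable_EFinP; exact: joint_measurable_section.
  - apply: emeasurable_funM => //.
    exact: measurable_singular_section.
  - by move=> y _; rewrite -EFinM lee_fin kc.
rewrite ge0_integralZl//; last 2 first.
- exact: measurable_singular_section.
- by move=> y _; rewrite lee_fin singular_kernel_ge0.
by rewrite EFinM lee_wpmul2l// ?lee_fin//; exact: integral_singular_kernel.
Qed.

Lemma dominated_Rintegral_le c k x : 0 <= c -> dominated c k ->
  `|\int[mu]_(y in Om) k x y| <= c * mass.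
Proof.
move=> c0 ck; have ik := dominated_integrable x ck.
rewrite -lee_fin EFin_normr_Rintegral//.
apply: le_trans (le_abse_integral _ mOm (measurable_int _ ik)) _.
apply: le_trans (dominated_integral_norm x c0 ck).
apply: ge0_subset_integral => //.
apply/measurableT_comp => //.
by apply/measurable_EFinP; apply: joint_measurable_section; case: ck.
Qed.

Lemma measurable_indic_fst : measurable_fun setT
  (fun z : 'rV[R]_d * 'rV[R]_d => \1_Om z.1 : R).
Proof.
by apply: (measurableT_comp (f := \1_Om : _ -> R)) => //; exact: measurable_indic.
Qed.

Lemma measurable_indic_snd : measurable_fun setT
  (fun z : 'rV[R]_d * 'rV[R]_d => \1_Om z.2 : R).
Proof.
by apply: (measurableT_comp (f := \1_Om : _ -> R)) => //; exact: measurable_indic.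
Qed.

Lemma dominated_indic_snd c k : dominated c k ->
  dominated c (fun x y => k x y * \1_Om y).
Proof.
move=> [mk kc]; split; first exact: measurable_funM mk measurable_indic_snd.
move=> x y; rewrite indicE; case: (_ \in _); rewrite ?mulr1// mulr0 normr0.
exact: le_trans (kc x y).
Qed.

(** Integrating over x first, the integral is bounded by a constant times the
    measure of Om, by symmetry of the singular kernel. *)
Lemma integrable_dominated_indic c k : 0 <= c -> dominated c k ->
  (mu \x mu)%E.-integrable setT (fun z => (k z.1 z.2 * \1_Om z.2)%:E).
Proof.
move=> c0 ck; have [mk kc] := ck; have [mk1 _] := dominated_indic_snd ck.
apply/integrable21ltyP; first exact/measurable_EFinP.
apply: (@le_lt_trans _ _ (\int[mu]_y ((c * mass)%:E * (\1_Om y)%:E))%E).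
  apply: ge0_le_integral => //.
  - by move=> y _; exact: integral_ge0.
  - apply: (measurable_fun_fubini_tonelli_G
      (fun z => `|(k z.1 z.2 * \1_Om z.2)%:E|%E)) => //.
    by apply: measurableT_comp => //; exact/measurable_EFinP.
  - by apply: emeasurable_funM => //; exact/measurable_EFinP/measurable_indic.
  move=> y _ /=; rewrite indicE; case: (_ \in _) => /=; last first.
    by rewrite mule0; under eq_integral do rewrite mulr0 normr0; rewrite integral0.
  under eq_integral do rewrite mulr1.
  by rewrite mule1; exact: (dominated_integral_norm y c0 (dominated_swap ck)).
have m0 : 0 <= c * mass.
  by rewrite mulr_ge0// !divr_ge0 ?mulr_ge0 ?exprn_ge0 ?sqrtr_ge0// ltW.
rewrite ge0_integralZl ?lee_fin//; last first.
  by apply/measurable_EFinP; exact: measurable_indic.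
by rewrite integral_indic// setIT lte_mul_pinfty// ?lee_fin.
Qed.

Lemma measurable_dominated_Rintegral c k : 0 <= c -> dominated c k ->
  measurable_fun setT (fun x => \int[mu]_(y in Om) k x y).
Proof.
move=> c0 ck; have /measurable_fubini_F := integrable_dominated_indic c0 ck.
rewrite /fubini_F => /= mF.
rewrite (_ : (fun x => _) =
  (fun x => fine (\int[mu]_y (k x y * \1_Om y)%:E)%E)).
  exact: (measurableT_comp (@fine_measurable _ _ measurableT) mF).
by apply/funext => x; rewrite /Rintegral integral_indicE.
Qed.

Lemma integrable_dominated_Rintegral c k : 0 <= c -> dominated c k ->
  mu.-integrable Om (fun x => (\int[mu]_(y in Om) k x y)%:E).
Proof.
move=> c0 ck; apply: measurable_bounded_integrable => //.
  by apply: measurable_funTS; exact: measurable_dominated_Rintegral c0 ck.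
exists (c * mass); split; first exact: num_real.
move=> M cM x Ox; apply: le_trans (ltW cM).
exact: dominated_Rintegral_le.
Qed.

Lemma dominated_Fubini c k : 0 <= c -> dominated c k ->
  \int[mu]_(x in Om) \int[mu]_(y in Om) k x y =
  \int[mu]_(x in Om) \int[mu]_(y in Om) k y x.
Proof.
move=> c0 ck; have ck' := dominated_swap ck.
pose f (z : 'rV[R]_d * 'rV[R]_d) := (k z.1 z.2 * \1_Om z.2 * \1_Om z.1)%:E.
have intf : (mu \x mu)%E.-integrable setT f.
  apply: le_integrable (integrable_dominated_indic c0 ck) => //.
    apply/measurable_EFinP/measurable_funM; last exact: measurable_indic_fst.
    by have [] := dominated_indic_snd ck.
  move=> z _; rewrite lee_fin normrM ler_piMr// indicE.
  by case: (_ \in _); rewrite ?normr1 ?normr0.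
have inner (k' : 'rV[R]_d -> 'rV[R]_d -> R) x : dominated c k' ->
    (\int[mu]_y (k' x y * \1_Om y * \1_Om x)%:E)%E =
    ((\int[mu]_(y in Om) k' x y) * \1_Om x)%:E.
  move=> ck1; rewrite EFinM fineK; last first.
    by apply: integrable_fin_num => //; exact: (dominated_integrable x ck1).
  rewrite integral_indicE -integralZr//.
  exact: (dominated_integrableT x (dominated_indic_snd ck1)).
have := Fubini intf; rewrite /f /=.
under eq_integral do rewrite inner//.
under [in X in _ = X]eq_integral => y _.
  under eq_integral do rewrite mulrAC.
  rewrite (inner (fun x y => k y x))//.
  over.
by rewrite -!integral_indicE /Rintegral => ->.
Qed.

End dominated_kernels.

(** * Nonlocal operators acting through bonds *)

Section bond_operators.
Context (R : realType) (d : nat) (eps : R) (Om : set 'rV[R]_d).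
Hypotheses (d2 : (2 <= d)%N) (eps0 : 0 < eps).
Hypotheses (mOm : measurable Om) (finOm : (lebesgue_rV R d Om < +oo)%E).
Local Notation mu := (lebesgue_rV R d).
Local Notation kernel := (singular_kernel eps).
Local Notation mass := (singular_mass d eps).
Local Notation dominated := (dominated eps).
Implicit Types (x y : 'rV[R]_d) (phi psi k : 'rV[R]_d -> 'rV[R]_d -> R) (c : R).
Implicit Types (u w : 'rV[R]_d -> 'rV[R]_d).

(** The common form of the force operator and of its derivative: phi x y is
    the density of the bond between x and y, and it acts along the bond. *)
Definition bond_op phi x : 'rV[R]_d :=
  \row_i - \int[mu]_(y in eball x eps `&` Om) (phi x y * direction y x 0 i).

(** Truncating the density at distance eps instead of the domain makes the
    domain of integration independent of x. *)
Definition horizon_cut phi x y : R := if enorm (y - x) < eps then phi x y else 0.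

Definition bond_density c phi := joint_measurable phi /\ forall x y,
  enorm (y - x) < eps ->
  `|phi x y| <= c * ((enorm (y - x))^-1 * (Num.sqrt (enorm (y - x)))^-1).

Definition bounded_measurable u :=
  measurable_fun setT u /\ exists M, forall x, enorm (u x) <= M.

Lemma horizon_cut_Rintegral phi x :
  \int[mu]_(y in eball x eps `&` Om) phi x y =
  \int[mu]_(y in Om) horizon_cut phi x y.
Proof.
rewrite Rintegral_mkcondl; apply: eq_Rintegral => y _.
rewrite patchE /horizon_cut; case: ifPn => [/set_mem -> //|].
by case: ifPn => // h /negP; rewrite inE.
Qed.

Lemma measurable_distance : joint_measurable (fun x y => enorm (y - x)).
Proof. by apply: measurable_enorm; exact: measurable_subv. Qed.

Lemma measurable_horizon_cut phi : joint_measurable phi ->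
  joint_measurable (horizon_cut phi).
Proof.
move=> mphi; apply: measurable_fun_ifT => //.
by apply: measurable_fun_ltr => //; exact: measurable_distance.
Qed.

Lemma measurable_direction_coord i :
  joint_measurable (fun x y => direction y x 0 i).
Proof. by apply: measurable_coordT; exact: measurable_direction. Qed.

Lemma dominated_bond_density c phi : bond_density c phi ->
  dominated c (horizon_cut phi).
Proof.
move=> [mphi phic]; split; first exact: measurable_horizon_cut.
move=> x y; rewrite /horizon_cut /singular_kernel; case: ifPn => xy.
  exact: phic.
by rewrite normr0 mulr0.
Qed.

Lemma dominated_horizon_cut c a phi h : 0 <= a -> bond_density c phi ->
  joint_measurable h -> (forall x y, `|h x y| <= a) ->
  dominated (c * a) (horizon_cut (fun x y => phi x y * h x y)).
Proof.
move=> a0 [mphi phic] mh ha; split.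
  by apply: measurable_horizon_cut; exact: measurable_funM.
move=> x y; rewrite /horizon_cut /singular_kernel; case: ifPn => xy; last first.
  by rewrite normr0 mulr0.
by rewrite normrM mulrAC ler_pM// phic.
Qed.

Lemma dominated_direction c phi i : bond_density c phi ->
  dominated c (horizon_cut (fun x y => phi x y * direction y x 0 i)).
Proof.
move=> cphi; rewrite -[c]mulr1; apply: dominated_horizon_cut => //.
  exact: measurable_direction_coord.
by move=> x y; exact: direction_coord_le1.
Qed.

Lemma bond_opE phi x i : bond_op phi x 0 i =
  - \int[mu]_(y in Om) horizon_cut (fun x y => phi x y * direction y x 0 i) x y.
Proof. by rewrite mxE -horizon_cut_Rintegral. Qed.

Lemma bond_op_bound c phi x : 0 <= c -> bond_density c phi ->
  enorm (bond_op phi x) <= d%:R * (c * mass).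
Proof.
move=> c0 cphi; apply: enorm_le_coord => i; rewrite bond_opE normrN.
by apply: dominated_Rintegral_le => //; exact: dominated_direction.
Qed.

Lemma measurable_bond_op c phi : 0 <= c -> bond_density c phi ->
  measurable_fun setT (bond_op phi).
Proof.
move=> c0 cphi; apply: measurable_fun_rVP => i.
under eq_fun do rewrite bond_opE.
apply: measurable_funN.
apply: (measurable_dominated_Rintegral d2 eps0 _ _ c0) => //.
exact: dominated_direction.
Qed.

Lemma bounded_measurable_bond_op c phi : 0 <= c -> bond_density c phi ->
  bounded_measurable (bond_op phi).
Proof.
move=> c0 cphi; split; first exact: measurable_bond_op c0 cphi.
by exists (d%:R * (c * mass)) => x; exact: bond_op_bound.
Qed.

Lemma bond_densityB c1 c2 phi psi : bond_density c1 phi ->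
  bond_density c2 psi -> bond_density (c1 + c2) (fun x y => phi x y - psi x y).
Proof.
move=> [mphi phic] [mpsi psic]; split; first exact: measurable_funB.
move=> x y xy; apply: le_trans (ler_normB _ _) _.
by rewrite mulrDl lerD ?phic ?psic.
Qed.

Lemma bond_opB c1 c2 phi psi x : bond_density c1 phi -> bond_density c2 psi ->
  bond_op phi x - bond_op psi x = bond_op (fun x y => phi x y - psi x y) x.
Proof.
move=> dphi dpsi; apply/rowP => i.
have subE (a b : 'rV[R]_d) : (a - b) 0 i = a 0 i - b 0 i by rewrite !mxE.
rewrite subE.
rewrite !bond_opE -opprD -RintegralB//; last 2 first.
- exact: (dominated_integrable d2 eps0 mOm x (dominated_direction i dphi)).
- exact: (dominated_integrable d2 eps0 mOm x (dominated_direction i dpsi)).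
congr (- _); apply: eq_Rintegral => y _; rewrite /horizon_cut.
by case: ifPn => _; rewrite ?mulrBl ?subr0.
Qed.

Lemma eq_bond_op phi psi x : (forall y, Om y -> phi x y = psi x y) ->
  bond_op phi x = bond_op psi x.
Proof.
move=> e; apply/rowP => i; rewrite /bond_op !mxE; congr (- _).
by apply: eq_Rintegral => y /set_mem[_ Oy]; rewrite e.
Qed.

Lemma bond_op_ae phi psi x : joint_measurable phi -> joint_measurable psi ->
  {ae mu, forall y, Om y -> phi x y = psi x y} -> bond_op phi x = bond_op psi x.
Proof.
move=> mphi mpsi phipsi; apply/rowP => i; rewrite !bond_opE; congr (- fine _).
have mc k : joint_measurable k ->
    measurable_fun Om
      (fun y => (horizon_cut (fun x y => k x y * direction y x 0 i) x y)%:E).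
  move=> mk; apply/measurable_EFinP/measurable_funTS.
  apply: (joint_measurable_section x); apply: measurable_horizon_cut.
  by apply: measurable_funM => //; exact: measurable_direction_coord.
apply: ae_eq_integral => //; [exact: mc|exact: mc|].
by apply: filterS phipsi => y + Oy => /(_ Oy) e; rewrite /horizon_cut e.
Qed.

(** Exchanging the names of x and y in the double integral of phi e.w(x)
    changes the sign of the direction e, since phi is symmetric; the
    right-hand side is the average of the two expressions. *)
Lemma bond_op_weak c phi w : 0 <= c -> bond_density c phi ->
  (forall x y, phi x y = phi y x) -> bounded_measurable w ->
  \int[mu]_(x in Om) dotv (bond_op phi x) (w x) =
  2^-1 * \int[mu]_(x in Om) \int[mu]_(y in eball x eps `&` Om)
    (phi x y * dotv (w y - w x) (direction y x)).
Proof.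
move=> c0 dphi phiC [mw [M wM]].
have M0 : 0 <= M by apply: le_trans (wM 0); exact: enorm_ge0.
pose h x y := dotv (direction y x) (w x).
pose k := horizon_cut (fun x y => phi x y * h x y).
have mh : joint_measurable h.
  apply: measurable_dotv; first exact: measurable_direction.
  exact: (measurableT_comp mw).
have hM x y : `|h x y| <= M.
  apply: le_trans (cauchy_schwarz _ _) _; rewrite -[leRHS]mul1r.
  by rewrite ler_pM ?enorm_direction_le1.
have dk : dominated (c * M) k by exact: dominated_horizon_cut.
have dk' := dominated_swap dk.
have cM : 0 <= c * M by exact: mulr_ge0.
have I1 : \int[mu]_(x in Om) dotv (bond_op phi x) (w x) =
    - \int[mu]_(x in Om) \int[mu]_(y in Om) k x y.
  rewrite -mulN1r -RintegralZl//; last first.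
    exact: (integrable_dominated_Rintegral d2 eps0 mOm finOm cM dk).
  apply: eq_Rintegral => x _; rewrite mulN1r.
  rewrite /dotv; under eq_bigr do rewrite bond_opE mulNr.
  rewrite sumrN; congr (- _).
  under eq_bigr => i _.
    rewrite -RintegralZr//; last first.
      exact: (dominated_integrable d2 eps0 mOm x (dominated_direction i dphi)).
    over.
  rewrite -Rintegral_sum//; last first.
    move=> i.
    apply: (eq_integrable mOm (fun y => (w x 0 i)%:E *
      (horizon_cut (fun x y => phi x y * direction y x 0 i) x y)%:E)%E).
      by move=> y _; rewrite /= mulrC EFinM.
    apply: integrableZl => //.
    exact: (dominated_integrable d2 eps0 mOm x (dominated_direction i dphi)).
  apply: eq_Rintegral => y _; rewrite /k /horizon_cut /h.
  case: ifPn => _; last by rewrite big1// => i _; rewrite mul0r.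
  by rewrite mulr_sumr; apply: eq_bigr => i _; rewrite mulrA.
rewrite I1; under [X in _ * X]eq_Rintegral => x _.
  rewrite (horizon_cut_Rintegral
      (fun x y => phi x y * dotv (w y - w x) (direction y x)))
    (@eq_Rintegral _ _ _ _ _ (fun y => - 1 * (k y x + k x y)));
    last first.
    move=> y _; rewrite /k /horizon_cut /h (enormB x y) (phiC y x).
    case: ifPn => _; last first.
      by rewrite addr0 mulr0.
    by rewrite (directionC y x) dotvNl dotvBl !(dotvC _ (direction y x)); ring.
  rewrite RintegralZl//; last first.
    exact: (integrableD mOm (dominated_integrable d2 eps0 mOm x dk')
      (dominated_integrable d2 eps0 mOm x dk)).
  rewrite RintegralD//; last 2 first.
  - exact: (dominated_integrable d2 eps0 mOm x dk').
  - exact: (dominated_integrable d2 eps0 mOm x dk).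
  over.
have i1 := integrable_dominated_Rintegral d2 eps0 mOm finOm cM dk.
have i2 := integrable_dominated_Rintegral d2 eps0 mOm finOm cM dk'.
rewrite RintegralZl//; last exact: (integrableD mOm i2 i1).
rewrite RintegralD// -(dominated_Fubini d2 eps0 mOm finOm cM dk).
by field.
Qed.

(** A rigid displacement does not stretch any bond: w y - w x = Q (y - x) is
    orthogonal to y - x. *)
Lemma skew_dotv0 (Q : 'M[R]_d) (v : 'rV[R]_d) :
  Q^T = - Q -> dotv (v *m Q^T) v = 0.
Proof.
move=> Qskew; suff : dotv (v *m Q^T) v = - dotv (v *m Q^T) v by lra.
rewrite /dotv -sumrN; under eq_bigr do rewrite mxE mulr_suml.
under [RHS]eq_bigr do rewrite mxE mulr_suml -sumrN.
rewrite exchange_big; apply: eq_bigr => i _; apply: eq_bigr => j _.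
by rewrite [in RHS]Qskew !mxE; ring.
Qed.

Lemma rigid_bounded w : bounded_set Om -> rigid w ->
  measurable_fun setT w /\ exists M, forall x, Om x -> enorm (w x) <= M.
Proof.
move=> bOm [Q [b [_ ->{w}]]]; split.
  apply: measurable_addv => //; apply: measurable_fun_rVP => i.
  under eq_fun do rewrite mxE.
  apply: measurable_sum => j; apply: measurable_funM => //.
  exact: measurable_coord.
have [M M0 OM] := bounded_set_coord bOm.
pose N := \sum_i \sum_j M * `|Q^T j i| + \sum_i `|b 0 i|.
exists (d%:R * N) => x Ox; apply: enorm_le_coord => i.
rewrite mxE; apply: le_trans (ler_normD _ _) _; apply: lerD; last first.
  by rewrite (bigD1 i)//= lerDl sumr_ge0.
rewrite mxE [leRHS](bigD1 i)//=; apply: le_trans (ler_norm_sum _ _ _) _.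
rewrite -[leLHS]addr0; apply: lerD; last first.
  by rewrite sumr_ge0// => j _; rewrite sumr_ge0// => ? _; rewrite mulr_ge0.
apply: ler_sum => j _; rewrite normrM ler_wpM2r//.
by have := OM _ Ox j; rewrite /= mxE in_itv/= sub0r add0r -ler_norml.
Qed.

(** In the weak form, tested with a rigid motion, every bond contributes 0.
    This is why the force operator takes its values in the orthogonal
    complement of rigid motions. *)
Lemma bond_op_rigid c phi w : bounded_set Om -> 0 <= c -> bond_density c phi ->
  (forall x y, phi x y = phi y x) -> rigid w ->
  \int[mu]_(x in Om) dotv (bond_op phi x) (w x) = 0.
Proof.
move=> bOm c0 dphi phiC rw; have [Q [b [Qskew wE]]] := rw.
rewrite {}wE in rw *.
(* The weak form needs a test field that is bounded everywhere. *)
pose w' x : 'rV[R]_d := \1_Om x *: (x *m Q^T + b).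
have w'E x : Om x -> w' x = x *m Q^T + b.
  by move=> Ox; rewrite /w' indicE mem_set// scale1r.
have bw' : bounded_measurable w'.
  have [mw [M wM]] := rigid_bounded bOm rw.
  split; first by apply: measurable_scalev => //; exact: measurable_indic.
  exists (Num.max 0 M) => x; rewrite /w' indicE.
  case: (boolP (x \in Om)) => [/set_mem Ox|_]; last first.
    by rewrite scale0r enorm0 le_max lexx.
  by rewrite scale1r le_max wM// orbT.
rewrite (@eq_Rintegral _ _ _ _ _ (fun x => dotv (bond_op phi x) (w' x)));
  last first.
  by move=> x /set_mem Ox; rewrite w'E.
rewrite (bond_op_weak c0 dphi phiC bw').
rewrite (@eq_Rintegral _ _ _ _ _ (fun=> 0)).
  by rewrite Rintegral_cst// mul0r mulr0.
move=> x /set_mem Ox; rewrite (@eq_Rintegral _ _ _ _ _ (fun=> 0)).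
  by rewrite /Rintegral integral0.
move=> y /set_mem[_ Oy]; rewrite !w'E// opprD addrACA subrr addr0.
by rewrite -mulmxBl dotvZr skew_dotv0// !mulr0.
Qed.

End bond_operators.

(** * Essentially bounded fields modulo rigid motions *)

Section essentially_bounded_fields.
Context (R : realType) (d : nat) (Om : set 'rV[R]_d).
Hypotheses (mOm : measurable Om) (bOm : bounded_set Om).
Local Notation mu := (lebesgue_rV R d).
Local Notation field := ('rV[R]_d -> 'rV[R]_d).
Implicit Types (u v w f : field) (c : R).

Let finOm : (mu Om < +oo)%E.
Proof. exact: bounded_set_fin_measure. Qed.

(** Preferred to a bound on Linf_norm because it combines pointwise with other
    almost everywhere statements. *)
Definition ae_bounded u c := {ae mu, forall x, Om x -> enorm (u x) <= c}.

Lemma Linf_norm_leP u c : 0 <= c ->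
  ((Linf_norm Om u <= c%:E)%E <-> ae_bounded u c).
Proof.
move=> c0; rewrite /Linf_norm Lnorm.unlock lebesgue_rV_setT_gt0.
split=> [/ess_supP|] h; last apply/ess_supP.
  apply: filterS h => x /= + Ox; rewrite patchE mem_set//= lee_fin.
  by rewrite ger0_norm.
apply: filterS h => x /= h; rewrite patchE; case: ifPn => [/set_mem Ox|_].
  by rewrite /= lee_fin ger0_norm// h.
by rewrite /= normr0 lee_fin.
Qed.

Definition Linf_size u : R := fine (Linf_norm Om u).

Lemma Linf_norm_ge0 u : (0 <= Linf_norm Om u)%E.
Proof. exact: Lnorm_ge0. Qed.

Lemma Linf_size_ge0 u : 0 <= Linf_size u.
Proof. by rewrite fine_ge0// Linf_norm_ge0. Qed.

Lemma Linf_sizeE u : Linf Om u -> Linf_norm Om u = (Linf_size u)%:E.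
Proof. by move=> [_ ui]; rewrite fineK// ge0_fin_numE// Linf_norm_ge0. Qed.

Lemma ae_bounded_size u : Linf Om u -> ae_bounded u (Linf_size u).
Proof.
by move=> uL; apply/Linf_norm_leP; rewrite ?Linf_size_ge0// Linf_sizeE.
Qed.

Lemma Linf_size_le u c : Linf Om u -> 0 <= c -> ae_bounded u c -> Linf_size u <= c.
Proof. by move=> uL c0 /(Linf_norm_leP _ c0); rewrite Linf_sizeE. Qed.

Lemma ae_bounded_Linf u c : 0 <= c -> measurable_fun Om u -> ae_bounded u c ->
  Linf Om u.
Proof.
move=> c0 mu_ /(Linf_norm_leP _ c0) uc; split=> //.
exact: le_lt_trans uc (ltry _).
Qed.

Lemma ae_bounded_same u v c : ae_same Om u v -> ae_bounded u c -> ae_bounded v c.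
Proof. by apply: filterS2 => x h + Ox => /(_ Ox); rewrite h. Qed.

Lemma ae_same_sym u v : ae_same Om u v -> ae_same Om v u.
Proof. by apply: filterS => x h Ox; rewrite h. Qed.

Lemma ae_same_trans v u w : ae_same Om u v -> ae_same Om v w -> ae_same Om u w.
Proof. by apply: filterS2 => x h1 h2 Ox; rewrite h1// h2. Qed.

Lemma ae_bounded0 u v : ae_bounded (u \- v) 0 -> ae_same Om u v.
Proof.
apply: filterS => x h Ox; apply/eqP; rewrite -subr_eq0; apply/eqP/enorm_eq0.
by apply/eqP; rewrite eq_le enorm_ge0 h.
Qed.

Lemma ae_bounded_eps u c : (forall e, 0 < e -> ae_bounded u (c + e)) ->
  ae_bounded u c.
Proof.
move=> uc; have : {ae mu, forall x, forall n, Om x ->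
    enorm (u x) <= c + n.+1%:R^-1}.
  by apply: ae_foralln => n; apply: uc; rewrite invr_gt0.
apply: filterS => x ux Ox; apply/ler_addgt0Pr => e e0.
have [n _ /(_ n (leqnn n)) /= ne] := near_infty_natSinv_lt (PosNum e0).
by apply: le_trans (ux n Ox) _; rewrite lerD2l ltW.
Qed.

Lemma ae_bounded_le u c c' : c <= c' -> ae_bounded u c -> ae_bounded u c'.
Proof. by move=> cc; apply: filterS => x h Ox; apply: le_trans (h Ox) cc. Qed.

(** Estimates that hold almost everywhere hold everywhere on a measurable
    subset G of full measure. Fields are then replaced by their restriction to
    G, extended by 0, for which the estimates hold on the whole space. *)
Lemma ae_full_set (P : 'rV[R]_d -> Prop) : {ae mu, forall x, Om x -> P x} ->
  exists G, [/\ measurable G, G `<=` Om, forall x, G x -> P x &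
    {ae mu, forall x, Om x -> G x}].
Proof.
move=> [N [mN N0 NP]]; exists (Om `\` N); split.
- exact: measurableD.
- by move=> x [].
- move=> x [Ox Nx]; apply: contrapT => nP; apply: Nx; apply: NP => /= h.
  exact: nP (h Ox).
- exists N; split=> // x /= h; apply: contrapT => Nx; apply: h => Ox.
  by split.
Qed.

Definition vrestrict (G : set 'rV[R]_d) u : field := fun x => \1_G x *: u x.

Lemma vrestrict_in G u x : G x -> vrestrict G u x = u x.
Proof. by move=> Gx; rewrite /vrestrict indicE mem_set// scale1r. Qed.

Lemma vrestrict_out G u x : ~ G x -> vrestrict G u x = 0.
Proof. by move=> Gx; rewrite /vrestrict indicE memNset// scale0r. Qed.

Lemma measurable_vrestrict G u : measurable G -> G `<=` Om ->
  measurable_fun Om u -> measurable_fun setT (vrestrict G u).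
Proof.
move=> mG GO mu_; apply: measurable_fun_rVP => i.
rewrite (_ : (fun x => _) = (fun x => u x 0 i) \_ G).
  apply/(measurable_restrictT _ mG).
  apply: (measurable_funS mOm GO).
  exact: (measurableT_comp (measurable_coord i) mu_).
apply/funext => x; rewrite patchE; case: ifPn => [/set_mem Gx|/negP].
  by rewrite vrestrict_in.
by rewrite inE => Gx; rewrite vrestrict_out// mxE.
Qed.

Lemma measurable_vrestrictP u :
  measurable_fun setT (vrestrict Om u) -> measurable_fun Om u.
Proof.
move=> /(@measurable_funTS _ _ _ _ Om); apply: eq_measurable_fun => x /set_mem Ox.
by rewrite vrestrict_in.
Qed.

Lemma measurable_fun_addv u v : measurable_fun Om u -> measurable_fun Om v ->
  measurable_fun Om (u \+ v).
Proof.
move=> mu_ mv; apply: measurable_vrestrictP.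
rewrite (_ : vrestrict Om _ = fun x => vrestrict Om u x + vrestrict Om v x).
  by apply: measurable_addv; exact: measurable_vrestrict.
by apply/funext => x; rewrite /vrestrict -scalerDr.
Qed.

Lemma measurable_fun_subv u v : measurable_fun Om u -> measurable_fun Om v ->
  measurable_fun Om (u \- v).
Proof.
move=> mu_ mv; apply: measurable_vrestrictP.
rewrite (_ : vrestrict Om _ = fun x => vrestrict Om u x - vrestrict Om v x).
  by apply: measurable_subv; exact: measurable_vrestrict.
by apply/funext => x; rewrite /vrestrict -scalerBr.
Qed.

Lemma ae_boundedD u v a b : ae_bounded u a -> ae_bounded v b ->
  ae_bounded (u \+ v) (a + b).
Proof.
apply: filterS2 => x ua vb Ox; apply: le_trans (enormD _ _) _.
by apply: lerD; [exact: ua|exact: vb].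
Qed.

Lemma ae_boundedB u v a b : ae_bounded u a -> ae_bounded v b ->
  ae_bounded (u \- v) (a + b).
Proof.
apply: filterS2 => x ua vb Ox; apply: le_trans (enormD _ _) _.
by rewrite enormN; apply: lerD; [exact: ua|exact: vb].
Qed.

Lemma LinfD u v : Linf Om u -> Linf Om v -> Linf Om (u \+ v).
Proof.
move=> uL vL.
have := ae_boundedD (ae_bounded_size uL) (ae_bounded_size vL).
apply: ae_bounded_Linf; first by rewrite addr_ge0 ?Linf_size_ge0.
by apply: measurable_fun_addv; [case: uL|case: vL].
Qed.

Lemma LinfB u v : Linf Om u -> Linf Om v -> Linf Om (u \- v).
Proof.
move=> uL vL.
have := ae_boundedB (ae_bounded_size uL) (ae_bounded_size vL).
apply: ae_bounded_Linf; first by rewrite addr_ge0 ?Linf_size_ge0.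
by apply: measurable_fun_subv; [case: uL|case: vL].
Qed.

(** Continuity of the pairing with a fixed bounded field, with respect to the
    essential supremum norm. *)
Lemma dotv_integral u w c M : 0 <= c -> 0 <= M ->
  measurable_fun Om u -> ae_bounded u c ->
  measurable_fun setT w -> (forall x, Om x -> enorm (w x) <= M) ->
  mu.-integrable Om (fun x => (dotv (u x) (w x))%:E) /\
  `|\int[mu]_(x in Om) dotv (u x) (w x)| <= c * M * fine (mu Om).
Proof.
move=> c0 M0 mu_ uc mw wM.
have mf : measurable_fun Om (fun x => dotv (u x) (w x)).
  apply: (@eq_measurable_fun _ _ _ _ _ (fun x => dotv (vrestrict Om u x) (w x))).
    by move=> x /set_mem Ox; rewrite vrestrict_in.
  apply: measurable_funTS; apply: measurable_dotv => //.
  exact: measurable_vrestrict.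
have le : (\int[mu]_(x in Om) `|(dotv (u x) (w x))%:E| <=
    \int[mu]_(x in Om) (cst (c * M)%:E x))%E.
  apply: ae_ge0_le_integral => //.
  - by apply: measurableT_comp => //; exact/measurable_EFinP.
  - by move=> x _; rewrite lee_fin mulr_ge0.
  - apply: filterS uc => x uc Ox; rewrite /= lee_fin.
    apply: le_trans (cauchy_schwarz _ _) _.
    by rewrite ler_pM// ?uc// wM.
rewrite integral_cst// in le.
have intf : mu.-integrable Om (fun x => (dotv (u x) (w x))%:E).
  apply/integrableP; split; first exact/measurable_EFinP.
  apply: le_lt_trans le _.
  by rewrite lte_mul_pinfty// lee_fin mulr_ge0.
split=> //; rewrite -lee_fin EFin_normr_Rintegral//.
apply: le_trans (le_abse_integral _ mOm (measurable_int _ intf)) _.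
by apply: le_trans le _; rewrite [leRHS]EFinM fineK// ge0_fin_numE.
Qed.

Lemma Vspace_Linf u : Vspace Om u -> Linf Om u. Proof. by case. Qed.
Hint Resolve Vspace_Linf : core.

Lemma rigid_integrable u w : Linf Om u -> rigid w ->
  mu.-integrable Om (EFin \o (fun x => dotv (u x) (w x))).
Proof.
move=> uL rw; have [mw [M wM]] := rigid_bounded bOm rw.
have wM' x : Om x -> enorm (w x) <= `|M|.
  by move=> Ox; apply: le_trans (wM x Ox) (ler_norm _).
by have [] := dotv_integral (Linf_size_ge0 u) (normr_ge0 M) uL.1
  (ae_bounded_size uL) mw wM'.
Qed.

Lemma VspaceD u v : Vspace Om u -> Vspace Om v -> Vspace Om (u \+ v).
Proof.
move=> Vu Vv; split; first by apply: LinfD; exact: Vspace_Linf.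
move=> w rw; under eq_Rintegral do rewrite dotvDl.
rewrite RintegralD//; try by apply: rigid_integrable => //; exact: Vspace_Linf.
by rewrite Vu.2// Vv.2// addr0.
Qed.

Lemma VspaceB u v : Vspace Om u -> Vspace Om v -> Vspace Om (u \- v).
Proof.
move=> Vu Vv; split; first by apply: LinfB; exact: Vspace_Linf.
move=> w rw; under eq_Rintegral do rewrite dotvBl.
rewrite RintegralB//; try by apply: rigid_integrable => //; exact: Vspace_Linf.
by rewrite Vu.2// Vv.2// subrr.
Qed.

(** Orthogonality to a rigid motion passes to the limit since the pairing is
    continuous. *)
Lemma Vspace_closed u : measurable_fun Om u ->
  (forall e, 0 < e -> exists2 v, Vspace Om v & ae_bounded (u \- v) e) ->
  Vspace Om u.
Proof.
move=> mu_ ucl; have uL : Linf Om u.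
  have [v Vv uv] := ucl 1 ltr01.
  have := ae_boundedD uv (ae_bounded_size (Vspace_Linf Vv)).
  move=> /ae_bounded_same-/(_ u) h.
  apply: (@ae_bounded_Linf _ (1 + Linf_size v)) => //.
    by rewrite addr_ge0// Linf_size_ge0.
  by apply: h; apply: aeW => x _; rewrite /= subrK.
split=> // w rw; have [mw [M wM]] := rigid_bounded bOm rw.
have wM' x : Om x -> enorm (w x) <= `|M|.
  by move=> Ox; apply: le_trans (wM x Ox) (ler_norm _).
apply/eqP; rewrite -normr_le0; apply/ler_addgt0Pr => e e0; rewrite add0r.
pose D := `|M| * fine (mu Om) + 1.
have m0 : 0 <= fine (mu Om) by exact: fine_ge0.
have D0 : 0 < D by rewrite ltr_pwDr// mulr_ge0.
have [v Vv uv] := ucl (e / D) (divr_gt0 e0 D0).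
have [_] := dotv_integral (ltW (divr_gt0 e0 D0)) (normr_ge0 M)
  (LinfB uL (Vspace_Linf Vv)).1 uv mw wM'.
under eq_Rintegral do rewrite dotvBl.
rewrite RintegralB//; try by apply: rigid_integrable => //; exact: Vspace_Linf.
rewrite Vv.2// subr0 => h; apply: le_trans h _.
rewrite -mulrA mulrAC ler_pdivrMr// ler_wpM2l ?(ltW e0)//.
by rewrite lerDl.
Qed.

(** Outside a null set, s n -/+ 2a / 2^n are, coordinate by coordinate, a
    nondecreasing and a nonincreasing sequence, and the former stays below the
    latter. The limit is the supremum of the former: it lies between the two
    at every rank, which gives the rate of convergence at once. *)
Lemma Vspace_complete (s : nat -> field) (a : R) : 0 <= a ->
  (forall n, Vspace Om (s n)) ->
  (forall n, ae_bounded (s n.+1 \- s n) (a / 2 ^+ n)) ->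
  exists2 u, Vspace Om u &
    forall n, ae_bounded (u \- s n) (d%:R * (2 * a / 2 ^+ n)).
Proof.
move=> a0 Vs ds.
have /ae_full_set[G [mG GO GP Gae]] : {ae mu, forall x, Om x ->
    forall n, enorm (s n.+1 x - s n x) <= a / 2 ^+ n}.
  by apply: filterS (ae_foralln ds) => x h Ox n; exact: h.
pose r (n : nat) : R := 2 * a / 2 ^+ n.
have rS n : r n = a / 2 ^+ n + r n.+1.
  by rewrite /r exprS; field; rewrite expf_neq0.
have r0 n : 0 <= r n by rewrite divr_ge0 ?mulr_ge0 ?exprn_ge0.
pose t i x n : R := s n x 0 i - r n.
pose q i x n : R := s n x 0 i + r n.
have step i x n : G x -> `|s n.+1 x 0 i - s n x 0 i| <= a / 2 ^+ n.
  move=> Gx; apply: le_trans (GP x Gx n).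
  by have := coord_le_enorm (s n.+1 x - s n x) i; rewrite !mxE.
have tS i x n : G x -> t i x n <= t i x n.+1.
  by move=> /(step i x n); rewrite ler_norml /t (rS n) => /andP[]; lra.
have qS i x n : G x -> q i x n.+1 <= q i x n.
  by move=> /(step i x n); rewrite ler_norml /q (rS n) => /andP[]; lra.
have tq i x n m : G x -> t i x n <= q i x m.
  move=> Gx; have [nm|mn] := leqP n m.
    apply: (@le_trans _ _ (t i x m)); last by rewrite /t /q; have := r0 m; lra.
    apply: (@homo_leq _ (t i x) <=%O) => //; first exact: le_trans.
    by move=> k; exact: tS.
  apply: (@le_trans _ _ (q i x n)); first by rewrite /t /q; have := r0 n; lra.
  apply: (@homo_leq _ (q i x) (fun a b => b <= a)) => //; last exact: ltnW.
    by move=> ? ? ? h1 h2; exact: le_trans h2 h1.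
  by move=> k; exact: qS.
pose l i x : R := sup (range (t i x)).
have lb i x n : G x -> t i x n <= l i x.
  move=> Gx; apply: ub_le_sup; last by exists n.
  by exists (q i x 0%N) => _ [m _ <-]; exact: tq.
have ub i x n : G x -> l i x <= q i x n.
  move=> Gx; apply: ge_sup; first by exists (t i x 0%N), 0%N.
  by move=> _ [m _ <-]; exact: tq.
have ls i x n : G x -> `|l i x - s n x 0 i| <= r n.
  move=> Gx; have := lb i x n Gx; have := ub i x n Gx.
  by rewrite /t /q ler_norml => *; apply/andP; split; lra.
pose u x : 'rV[R]_d := \row_i (if x \in G then l i x else 0).
have uG x n : G x -> enorm (u x - s n x) <= d%:R * r n.
  move=> Gx; apply: enorm_le_coord => i; rewrite !mxE mem_set//.
  exact: ls.
have us n : ae_bounded (u \- s n) (d%:R * r n).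
  by apply: filterS Gae => x h /h Gx; exact: uG.
have rcvg : r n @[n --> \oo] --> (0 : R).
  rewrite -[X in _ --> X](mulr0 (2 * a)); apply: cvgMr.
  under eq_fun do rewrite -exprVn; apply: cvg_expr.
  by rewrite ger0_norm// invf_lt1// ltr1n.
have mu_ : measurable_fun setT u.
  apply: measurable_fun_rVP => i; under eq_fun do rewrite mxE.
  apply: (@measurable_fun_cvg _ _ _ _ (fun n x => vrestrict G (s n) x 0 i)).
    move=> n; apply: measurable_coordT; apply: measurable_vrestrict => //.
    exact: (Vs n).1.1.
  move=> x _; case: ifPn => [/set_mem Gx|/negP]; last first.
    rewrite inE => Gx; under eq_fun do rewrite vrestrict_out// mxE.
    exact: cvg_cst.
  under eq_fun do rewrite vrestrict_in//.
  apply/cvgrPdist_le => e e0; near=> n; apply: le_trans (ls i x n Gx) _.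
  apply: le_trans (ler_norm _) _; rewrite -[r n]subr0 distrC; near: n.
  by move/cvgrPdist_le : rcvg; exact.
exists u => //; apply: Vspace_closed; first exact: measurable_funTS.
move=> e e0.
have dr : d%:R * r n @[n --> \oo] --> (0 : R).
  by rewrite -[X in _ --> X](mulr0 (d%:R : R)); apply: cvgMr.
have /cvgrPdist_le /(_ e e0)[n _ /(_ n (leqnn n))] := dr.
rewrite /= sub0r normrN => dn; exists (s n) => //.
by apply: ae_bounded_le (us n); apply: le_trans (ler_norm _) dn.
Unshelve. all: by end_near. Qed.

End essentially_bounded_fields.

(** * Newton iteration with a fixed derivative *)

Section inverse_norm.
Context (R : realType) (d : nat) (Om : set 'rV[R]_d).
Hypotheses (mOm : measurable Om) (bOm : bounded_set Om).
Local Notation mu := (lebesgue_rV R d).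
Local Notation field := ('rV[R]_d -> 'rV[R]_d).
Local Notation ae_bounded := (ae_bounded Om).
Local Notation V := (Vspace Om).
Local Notation size := (Linf_size Om).
Variable A : field -> field.
Hypothesis Ainv : boundedly_invertible Om A.
Hypothesis AV : forall w, V w -> exists2 f, V f & ae_same Om (A w) f.
Local Notation N := (inverse_norm Om A).

Let quotients : set R := [set q | exists f w, [/\ V f, ~ ae_same Om f (cst 0),
  V w, ae_same Om (A w) f & q = fine (Linf_norm Om w) / fine (Linf_norm Om f)]].

Lemma Linf_norm_same u v : ae_same Om u v -> Linf Om v ->
  Linf_norm Om u = Linf_norm Om v.
Proof.
move=> uv vL; apply/eqP; rewrite eq_le; apply/andP; split.
  rewrite (Linf_sizeE vL); apply/Linf_norm_leP; first exact: Linf_size_ge0.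
  by apply: ae_bounded_same (ae_same_sym uv) _; exact: ae_bounded_size.
rewrite /Linf_norm Lnorm.unlock lebesgue_rV_setT_gt0.
apply: le_ess_sup; apply: filterS uv => x uv /=; rewrite !patchE.
by case: ifPn => // /set_mem Ox; rewrite uv.
Qed.

Let ae_same0 f : Linf Om f -> size f = 0 -> ae_same Om f (cst 0).
Proof.
move=> fL f0; have := ae_bounded_size fL; rewrite f0 => h.
apply: ae_bounded0; apply: filterS h => x h Ox.
by rewrite /= subr0 h.
Qed.

Let quotient_bound : exists2 M, 0 <= M & forall w f, V w -> V f ->
  ae_same Om (A w) f -> size w <= M * size f.
Proof.
have [_ _ [M AM]] := Ainv; exists `|M| => // w f Vw Vf Awf.
have := AM w Vw; rewrite (Linf_norm_same Awf (Vspace_Linf Vf)).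
rewrite !Linf_sizeE//; try exact: Vspace_Linf.
rewrite -EFinM lee_fin => h; apply: le_trans h _.
by rewrite ler_wpM2r ?ler_norm// Linf_size_ge0.
Qed.

Let quotients_ub : has_ubound quotients.
Proof.
have [M M0 wM] := quotient_bound.
exists M => _ [f [w [Vf f0 Vw Awf ->]]].
have sf : 0 < size f.
  rewrite lt_neqAle Linf_size_ge0 andbT eq_sym; apply/negP => /eqP sf0.
  by apply: f0; apply: ae_same0 => //; exact: Vspace_Linf.
by rewrite ler_pdivrMr//; exact: wM.
Qed.

(** If there is no quotient at all, the supremum is that of the empty set,
    which is 0. *)
Lemma inverse_norm_ge0 : 0 <= N.
Proof.
rewrite /inverse_norm -/quotients.
have [->|/set0P[q qq]] := eqVneq quotients set0; first by rewrite sup0.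
apply: le_trans (ub_le_sup quotients_ub qq).
by case: qq => f [w [_ _ _ _ ->]]; rewrite divr_ge0// Linf_size_ge0.
Qed.

(** The estimate for which the operator norm of the inverse is made. When A w
    is 0 there is no quotient to compare with, and the a priori bound of a
    boundedly invertible operator takes over. *)
Lemma inverse_norm_bound w c : V w -> 0 <= c -> ae_bounded (A w) c ->
  ae_bounded w (N * c).
Proof.
move=> Vw c0 Awc; have [f Vf Awf] := AV Vw.
have fc : size f <= c.
  by apply: Linf_size_le => //; [exact: Vspace_Linf|exact: ae_bounded_same Awc].
apply: ae_bounded_le (ae_bounded_size (Vspace_Linf Vw)).
have [f0|f0] := eqVneq (size f) 0.
  have [M M0 /(_ _ _ Vw Vf Awf)] := quotient_bound; rewrite f0 mulr0 => h.
  by apply: le_trans h _; rewrite mulr_ge0// inverse_norm_ge0.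
have sf : 0 < size f by rewrite lt_neqAle eq_sym f0 Linf_size_ge0.
apply: (@le_trans _ _ (N * size f)); last by rewrite ler_wpM2l// inverse_norm_ge0.
rewrite -ler_pdivrMr//; apply: ub_le_sup; first exact: quotients_ub.
exists f, w; split=> // fs0.
have : size f <= 0.
  apply: Linf_size_le => //; first exact: Vspace_Linf.
  by apply: filterS fs0 => x h Ox; rewrite h// enorm0.
by rewrite leNgt sf.
Qed.

End inverse_norm.

(** A stands for the derivative of F at u0: F_approx says that F u - F v is A
    (u - v) up to a small multiple kappa of the distance, as long as u and v
    stay in the ball of radius rad about u0. The condition N * kappa <= 1/2
    turns this into a contraction. *)
Section newton_iteration.
Context (R : realType) (d : nat) (Om : set 'rV[R]_d).
Hypotheses (mOm : measurable Om) (bOm : bounded_set Om).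
Local Notation mu := (lebesgue_rV R d).
Local Notation field := ('rV[R]_d -> 'rV[R]_d).
Local Notation ae_bounded := (ae_bounded Om).
Local Notation V := (Vspace Om).
Local Notation size := (Linf_size Om).
Variables (F A : field -> field) (u0 : field) (N K kappa rad : R).
Hypotheses (N0 : 0 <= N) (kappa0 : 0 <= kappa) (rad0 : 0 <= rad).
Hypothesis Nkappa : N * kappa <= 2^-1.
Hypothesis Vu0 : V u0.
Hypothesis FV : forall u, V u -> exists2 f, V f & ae_same Om (F u) f.
Hypothesis A_onto : forall f, V f -> exists2 w, V w & ae_same Om (A w) f.
Hypothesis A_inv : forall w c, V w -> 0 <= c -> ae_bounded (A w) c ->
  ae_bounded w (N * c).
Hypothesis A_bounded : forall w c, V w -> 0 <= c -> ae_bounded w c ->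
  ae_bounded (A w) (K * c).
Hypothesis F_approx : forall u v c, V u -> V v -> 0 <= c ->
  ae_bounded (u \- u0) rad -> ae_bounded (v \- u0) rad ->
  ae_bounded (u \- v) c ->
  ae_bounded (fun x => F u x - F v x - A (u \- v) x) (kappa * c).

(** Applying the inverse of A to A (u - v) = (F u - F v) - (F u - F v - A (u -
    v)) bounds the size of u - v by N c plus half of itself. *)
Lemma newton_stability u v c : V u -> V v -> 0 <= c ->
  ae_bounded (u \- u0) rad -> ae_bounded (v \- u0) rad ->
  ae_bounded (F u \- F v) c -> ae_bounded (u \- v) (2 * N * c).
Proof.
move=> Vu Vv c0 uB vB Fc; have Vuv := VspaceB mOm bOm Vu Vv.
have uvL := Vspace_Linf Vuv; have sz := ae_bounded_size uvL.
have s0 := Linf_size_ge0 Om (u \- v).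
have h1 := F_approx Vu Vv s0 uB vB sz.
have h2 : ae_bounded (A (u \- v)) (c + kappa * size (u \- v)).
  apply: filterS2 Fc h1 => x Fc h1 Ox.
  rewrite (_ : A _ x = (F u x - F v x) - (F u x - F v x - A (u \- v) x)).
    apply: le_trans (enormD _ _) _; rewrite enormN; apply: lerD.
      exact: Fc.
    exact: h1.
  by rewrite opprB addrC subrK.
have h3 := A_inv Vuv (addr_ge0 c0 (mulr_ge0 kappa0 s0)) h2.
have h4 := Linf_size_le uvL (mulr_ge0 N0 (addr_ge0 c0 (mulr_ge0 kappa0 s0))) h3.
apply: ae_bounded_le sz.
have : N * kappa * size (u \- v) <= 2^-1 * size (u \- v) by rewrite ler_wpM2r.
move: h4; rewrite mulrDr mulrA; lra.
Qed.

Variables (b0 : field) (rho : R).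
Hypotheses (rho0 : 0 <= rho) (Nrho : N * rho <= rad / 2).
Hypothesis Fu0 : ae_same Om (F u0) b0.

(** The iteration is u_{n+1} = u_n + w_n with A w_n = b - F u_n. The next
    residual is A w_{n+1} = A w_n - (F u_{n+1} - F u_n), which is the
    remainder of F_approx; hence the sizes of the w_n are halved at each step
    and the iterates stay in the ball. *)
Lemma newton_solution b : V b -> ae_bounded (b \- b0) rho ->
  exists2 u, V u & ae_bounded (u \- u0) rad /\ ae_same Om (F u) b.
Proof.
move=> Vb bb0.
have step u : exists w, V u -> V w /\ ae_same Om (A w) (b \- F u).
  have [Vu|] := pselect (V u); last by exists u0.
  have [f Vf Ff] := FV Vu.
  have [w Vw Aw] := A_onto (VspaceB mOm bOm Vb Vf).
  exists w => _; split=> //; apply: ae_same_trans Aw _.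
  by apply: filterS Ff => x h Ox; rewrite /= h.
have [w_ hw] := choice step.
pose s := fix s n := if n is m.+1 then s m \+ w_ (s m) else u0.
have Vs n : V (s n).
  by elim: n => // n ih /=; apply: VspaceD => //; have [] := hw _ ih.
pose a : R := rad / 2.
have a0 : 0 <= a by rewrite divr_ge0.
have an0 n : 0 <= a / 2 ^+ n by rewrite divr_ge0// exprn_ge0.
have inv n : ae_bounded (s n \- u0) (rad - rad / 2 ^+ n) /\
             ae_bounded (w_ (s n)) (a / 2 ^+ n).
  (* rad - rad / 2^n is the sum of the bounds rad / 2^k.+1 on the increments
     of rank k < n. *)
  elim: n => [|n [ih1 ih2]].
    split; first by apply: aeW => x _; rewrite /= subrr enorm0 expr0 divr1 subrr.
    rewrite expr0 divr1; apply: ae_bounded_le Nrho _.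
    have [Vw Aw] := hw _ Vu0; apply: A_inv => //.
    apply: filterS3 Aw Fu0 bb0 => x h1 h2 h3 Ox; rewrite h1//= h2//; exact: h3.
  have wn0 m : s m.+1 \- s m = w_ (s m).
    by apply/funext => x /=; rewrite addrAC subrr add0r.
  have rn m : rad - rad / 2 ^+ m <= rad.
    by rewrite lerBlDr lerDl divr_ge0// exprn_ge0.
  have ih1' : ae_bounded (s n.+1 \- u0) (rad - rad / 2 ^+ n.+1).
    have := ae_boundedD ih1 ih2; rewrite (_ : _ + _ = rad - rad / 2 ^+ n.+1).
      by apply: ae_bounded_same; apply: aeW => x _; rewrite /= addrAC.
    by rewrite /a exprS; field; rewrite expf_neq0.
  split=> //.
  have [Vw Aw] := hw _ (Vs n.+1); have [Vw' Aw'] := hw _ (Vs n).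
  have := F_approx (Vs n.+1) (Vs n) (an0 n) (ae_bounded_le (rn _) ih1')
    (ae_bounded_le (rn _) ih1); rewrite wn0 => /(_ ih2) q.
  have := A_inv Vw (mulr_ge0 kappa0 (an0 n)); move=> h.
  apply: (@ae_bounded_le _ _ _ _ (N * (kappa * (a / 2 ^+ n)))).
    rewrite mulrA; apply: le_trans (ler_wpM2r (an0 n) Nkappa) _.
    by rewrite exprS invfM; lra.
  apply: h; apply: filterS3 Aw Aw' q => x h1 h2 h3 Ox.
  rewrite h1// -enormN /=; apply: le_trans (h3 Ox); rewrite h2//=.
  rewrite le_eqVlt; apply/orP; left; apply/eqP; congr enorm.
  by rewrite !opprB addrA subrK.
have ds n : ae_bounded (s n.+1 \- s n) (a / 2 ^+ n).
  apply: filterS (inv n).2 => x h Ox.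
  by rewrite /= addrAC subrr add0r h.
have [u Vu us] := Vspace_complete mOm bOm a0 Vs ds.
pose r n : R := d%:R * (2 * a / 2 ^+ n).
have r0 n : 0 <= r n by rewrite mulr_ge0// divr_ge0 ?exprn_ge0// mulr_ge0.
have half : (2^-1 : R) ^+ n @[n --> \oo] --> (0 : R).
  by apply: cvg_expr; rewrite ger0_norm// invf_lt1// ltr1n.
have small (C e : R) : 0 < e -> exists n, C * 2^-1 ^+ n <= e.
  move=> e0; have : C * 2^-1 ^+ n @[n --> \oo] --> (0 : R).
    by rewrite -[X in _ --> X](mulr0 C); apply: cvgMr.
  move=> /cvgrPdist_le /(_ e e0)[n _ /(_ n (leqnn n))].
  by rewrite /= sub0r normrN => h; exists n; apply: le_trans (ler_norm _) h.
have uB : ae_bounded (u \- u0) rad.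
  apply: ae_bounded_eps => e e0.
  have [n re] := small (d%:R * (2 * a)) e e0.
  have := ae_boundedD (inv n).1 (us n).
  move=> /(ae_bounded_le (c' := rad + e)) h.
  apply: (@ae_bounded_same _ _ _ ((s n \- u0) \+ (u \- s n))).
    by apply: aeW => x Ox; rewrite /= [LHS]addrC addrA subrK.
  apply: h; apply: lerD; first by rewrite lerBlDr lerDl divr_ge0// exprn_ge0.
  by move: re; rewrite exprVn -mulrA.
exists u => //; split=> //; apply: ae_bounded0.
apply: ae_bounded_eps => e e0; rewrite add0r.
have rn m : rad - rad / 2 ^+ m <= rad.
  by rewrite lerBlDr lerDl divr_ge0// exprn_ge0.
have [n ne] := small ((kappa + K) * (d%:R * (2 * a)) + K * a) e e0.
have q := F_approx Vu (Vs n) (r0 n) uB (ae_bounded_le (rn _) (inv n).1) (us n).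
have Au := A_bounded (VspaceB mOm bOm Vu (Vs n)) (r0 n) (us n).
have [Vw Aw] := hw _ (Vs n).
have Awb := A_bounded Vw (an0 n) (inv n).2.
apply: ae_bounded_le ne _.
have bF := ae_bounded_same Aw Awb.
apply: filterS3 q Au bF => x h1 h2 h3 Ox.
rewrite (_ : (F u \- b) x = (F u x - F (s n) x - A (u \- s n) x)
   + A (u \- s n) x - (b \- F (s n)) x); last first.
  by rewrite /= subrK opprB addrA subrK.
apply: le_trans (enormD _ _) _; rewrite enormN.
apply: (@le_trans _ _ (kappa * r n + K * r n + K * (a / 2 ^+ n))).
  apply: lerD; last exact: h3.
  by apply: le_trans (enormD _ _) _; apply: lerD; [exact: h1|exact: h2].
by rewrite le_eqVlt; apply/orP; left; apply/eqP; rewrite /r exprVn; ring.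
Qed.

End newton_iteration.

(** * Strain and Taylor estimates for the bond forces *)

Section mean_value.
Context (R : realType).
Implicit Types (f : R -> R) (a b s m : R).

Lemma mean_value f a b : (forall x : R, derivable f x 1) ->
  exists2 xi, Num.min a b <= xi <= Num.max a b & f a - f b = derive1 f xi * (a - b).
Proof.
move=> df.
have dfE (x : R) : is_derive x 1 f (derive1 f x).
  by rewrite derive1E; exact: derivableP.
have cf : continuous f.
  by move=> x; apply/differentiable_continuous/derivable1_diffP; exact: df.
have [ab|/ltW ba] := leP a b.
  have [xi + e] := MVT_segment ab (fun x _ => dfE x)
    (continuous_subspaceT cf).
  rewrite in_itv/= => h; exists xi => //; rewrite -opprB e; ring.
have [xi + e] := MVT_segment ba (fun x _ => dfE x) (continuous_subspaceT cf).
by rewrite in_itv/= => h; exists xi.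
Qed.

Lemma between_dist a b s m xi : Num.min a b <= xi <= Num.max a b ->
  `|a - s| <= m -> `|b - s| <= m -> `|xi - s| <= m.
Proof.
rewrite !ler_distl ge_min le_max => /andP[/orP[] ? /orP[] ?] /andP[? ?] /andP[? ?];
apply/andP; split; lra.
Qed.

(** Two applications of the mean value theorem: the difference quotient of f
    between a and b is the derivative at an intermediate point, and this point
    is no farther from s than a and b are. *)
Lemma linearization_error f a b s m M :
  (forall x : R, derivable f x 1) -> (forall x : R, derivable (derive1 f) x 1) ->
  (forall x, `|derive1 (derive1 f) x| <= M) -> `|a - s| <= m -> `|b - s| <= m ->
  `|f a - f b - derive1 f s * (a - b)| <= M * m * `|a - b|.
Proof.
move=> df df' fM am bm.
have [xi xiab ->] := mean_value a b df.
have xim := between_dist xiab am bm.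
rewrite -mulrBl normrM ler_wpM2r//.
have [eta _ ->] := mean_value xi s df'.
by rewrite normrM ler_pM.
Qed.

(** By the mean value theorem, used twice, the gap between f and its tangent
    at a is f'' eta (xi - a) (b - a) with xi between a and b, so that the last
    two factors have the same sign. *)
Lemma convex_tangent f re rc a b :
  (forall x : R, derivable f x 1) -> (forall x : R, derivable (derive1 f) x 1) ->
  (forall x, re < x < rc -> 0 <= derive1 (derive1 f) x) ->
  re < a < rc -> re < b < rc -> derive1 f a * (b - a) <= f b - f a.
Proof.
move=> df df' f2 aI bI.
have sub x y z : re < x < rc -> re < y < rc -> Num.min x y <= z <= Num.max x y ->
    re < z < rc.
  move=> /andP[? ?] /andP[? ?]; rewrite ge_min le_max => /andP[/orP[] ? /orP[] ?];
  by apply/andP; split; lra.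
have [xi xiab ->] := mean_value b a df.
have xiI := sub _ _ _ bI aI xiab.
have [eta etab e] := mean_value xi a df'.
have etaI := sub _ _ _ xiI aI etab.
rewrite -subr_ge0 -mulrBl e -mulrA mulr_ge0 ?f2//.
move: xiab; rewrite ge_min le_max; have [ab|ba] := leP a b => h.
  by rewrite mulr_ge0// subr_ge0//; case/andP: h => /orP[] ? _; lra.
by rewrite mulr_le0// subr_le0 ?(ltW ba)//; case/andP: h => _ /orP[] ?; lra.
Qed.

End mean_value.

Section strain.
Context (R : realType) (d : nat).
Implicit Types (x y : 'rV[R]_d) (u v w : 'rV[R]_d -> 'rV[R]_d).

Lemma strainC u x y : strain x y u = strain y x u.
Proof.
rewrite /strain (enormB x y) (directionC y x) -(opprB (u y) (u x)).
by rewrite scalerN dotvNl dotvNr opprK.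
Qed.

Lemma scaled_strainC u x y : scaled_strain x y u = scaled_strain y x u.
Proof. by rewrite /scaled_strain strainC enormB. Qed.

Lemma strainB u v x y : strain y x (u \- v) = strain y x u - strain y x v.
Proof.
rewrite /strain -dotvBl -scalerBr; congr (dotv (_ *: _) _) => /=.
by rewrite opprD addrACA -opprD opprB addrC.
Qed.

Lemma scaled_strainB u v x y : scaled_strain y x u - scaled_strain y x v =
  Num.sqrt (enorm (y - x)) * strain y x (u \- v).
Proof. by rewrite /scaled_strain strainB mulrBr. Qed.

Lemma eq_strain u v x y : u x = v x -> u y = v y -> strain y x u = strain y x v.
Proof. by rewrite /strain => -> ->. Qed.

Lemma eq_scaled_strain u v x y : u x = v x -> u y = v y ->
  scaled_strain y x u = scaled_strain y x v.
Proof. by move=> ux uy; rewrite /scaled_strain (eq_strain ux uy). Qed.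

Lemma strain_le u x y c : enorm (u x) <= c -> enorm (u y) <= c ->
  `|strain y x u| <= 2 * c * (enorm (y - x))^-1.
Proof.
move=> ux uy; apply: le_trans (cauchy_schwarz _ _) _.
rewrite enormZ normfV ger0_norm// -[leRHS]mulr1.
apply: ler_pM; [by rewrite mulr_ge0// invr_ge0|by []| |exact: enorm_direction_le1].
rewrite mulrC ler_wpM2r ?invr_ge0//; apply: le_trans (enormD _ _) _.
by rewrite enormN; lra.
Qed.

Lemma joint_measurable_strain u : measurable_fun setT u ->
  joint_measurable (fun x y => strain y x u).
Proof.
move=> mu_; apply: measurable_dotv; last exact: measurable_direction.
apply: measurable_scalev.
  by apply: measurable_invr_ge0 => //; exact: measurable_distance.
by apply: measurable_subv; exact: (measurableT_comp mu_).
Qed.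

Lemma joint_measurable_scaled_strain u : measurable_fun setT u ->
  joint_measurable (fun x y => scaled_strain y x u).
Proof.
move=> mu_; apply: measurable_funM; last exact: joint_measurable_strain.
by apply: measurable_sqrtr; exact: measurable_distance.
Qed.

Lemma unit_ball_volume_ge0 : 0 <= unit_ball_volume R d.
Proof. exact: fine_ge0. Qed.

End strain.

Section densities.
Context (R : realType) (d : nat) (J g : R -> R) (re rc eps : R).
Hypotheses (hJ : influence_function J) (hg : potential g re rc) (eps0 : 0 < eps).
Local Notation mu := (lebesgue_rV R d).
Local Notation omega := (unit_ball_volume R d).
Local Notation field := ('rV[R]_d -> 'rV[R]_d).
Implicit Types (x y : 'rV[R]_d) (u v w : field).

Definition force_density u x y : R :=
  2 * Jeps J eps (enorm (y - x))
    / (eps ^+ d.+1 * omega * Num.sqrt (enorm (y - x)))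
    * derive1 g (scaled_strain y x u).

Definition dforce_density u w x y : R :=
  2 * Jeps J eps (enorm (y - x)) / (eps ^+ d.+1 * omega)
    * derive1n 2 g (scaled_strain y x u) * strain y x w.

Lemma forceE Om u : force J g Om eps u = bond_op eps Om (force_density u).
Proof. by []. Qed.

Lemma dforceE Om u w : dforce J g Om eps u w = bond_op eps Om (dforce_density u w).
Proof. by []. Qed.

Lemma force_densityE u x y : force_density u x y =
  2 * Jeps J eps (enorm (y - x)) / (eps ^+ d.+1 * omega) *
  ((Num.sqrt (enorm (y - x)))^-1 * derive1 g (scaled_strain y x u)).
Proof. by rewrite /force_density invfM; ring. Qed.

Lemma force_densityC u x y : force_density u x y = force_density u y x.
Proof. by rewrite /force_density enormB scaled_strainC. Qed.

Lemma dforce_densityC u w x y : dforce_density u w x y = dforce_density u w y x.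
Proof. by rewrite /dforce_density enormB scaled_strainC (strainC w). Qed.

Lemma eq_force_density u v x y : u x = v x -> u y = v y ->
  force_density u x y = force_density v x y.
Proof. by move=> ux uy; rewrite /force_density (eq_scaled_strain ux uy). Qed.

Lemma eq_dforce_density u v w1 w2 x y : u x = v x -> u y = v y ->
  w1 x = w2 x -> w1 y = w2 y ->
  dforce_density u w1 x y = dforce_density v w2 x y.
Proof.
move=> ux uy wx wy.
by rewrite /dforce_density (eq_scaled_strain ux uy) (eq_strain wx wy).
Qed.

Lemma derivable_g (r : R) : derivable g r 1.
Proof. exact: (potential_derivable hg (n := 0)). Qed.

Lemma derivable_dg (r : R) : derivable (derive1 g) r 1.
Proof. exact: (potential_derivable hg (n := 1)). Qed.

Lemma derivable_ddg (r : R) : derivable (derive1 (derive1 g)) r 1.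
Proof. exact: (potential_derivable hg (n := 2)). Qed.

Lemma measurable_derivable (f : R -> R) :
  (forall r : R, derivable f r 1) -> measurable_fun setT f.
Proof.
move=> df; apply: continuous_measurable_fun => r.
by apply/differentiable_continuous/derivable1_diffP.
Qed.

Lemma joint_measurable_Jeps :
  joint_measurable (fun x y : 'rV[R]_d => Jeps J eps (enorm (y - x))).
Proof.
apply: (measurableT_comp (influence_measurable hJ)).
by apply: measurable_funM => //; exact: measurable_distance.
Qed.

Lemma joint_measurable_force_density u : measurable_fun setT u ->
  joint_measurable (force_density u).
Proof.
move=> mu_; apply: measurable_funM; last first.
  apply: (measurableT_comp (measurable_derivable derivable_dg)).
  exact: joint_measurable_scaled_strain.
apply: measurable_funM.
  by apply: measurable_funM => //; exact: joint_measurable_Jeps.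
apply: measurable_invr_ge0.
  move=> z; rewrite !mulr_ge0 ?exprn_ge0 ?(ltW eps0) ?sqrtr_ge0//.
  exact: unit_ball_volume_ge0.
apply: measurable_funM => //.
by apply: measurable_sqrtr; exact: measurable_distance.
Qed.

Lemma joint_measurable_dforce_density u w : measurable_fun setT u ->
  measurable_fun setT w -> joint_measurable (dforce_density u w).
Proof.
move=> mu_ mw; apply: measurable_funM; last exact: joint_measurable_strain.
apply: measurable_funM; last first.
  apply: (measurableT_comp (measurable_derivable derivable_ddg)).
  exact: joint_measurable_scaled_strain.
apply: measurable_funM => //.
by apply: measurable_funM => //; exact: joint_measurable_Jeps.
Qed.

Variables MJ M1 M2 M3 : R.
Hypotheses (JM : forall r, J r <= MJ) (gM1 : forall r, `|derive1 g r| <= M1).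
Hypotheses (gM2 : forall r, `|derive1 (derive1 g) r| <= M2).
Hypotheses (gM3 : forall r, `|derive1 (derive1 (derive1 g)) r| <= M3).

(** A bound for the factor of the bond forces that does not depend on the
    displacement. *)
Definition amplitude : R := 2 * MJ / (eps ^+ d.+1 * omega).

Lemma MJ_ge0 : 0 <= MJ.
Proof. exact: le_trans (influence_ge0 hJ 0) (JM 0). Qed.

Lemma M1_ge0 : 0 <= M1. Proof. exact: le_trans (normr_ge0 _) (gM1 0). Qed.
Lemma M2_ge0 : 0 <= M2. Proof. exact: le_trans (normr_ge0 _) (gM2 0). Qed.
Lemma M3_ge0 : 0 <= M3. Proof. exact: le_trans (normr_ge0 _) (gM3 0). Qed.

Lemma volume_factor_ge0 : 0 <= (eps ^+ d.+1 * omega)^-1.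
Proof.
rewrite invr_ge0 mulr_ge0 ?exprn_ge0 ?(ltW eps0)//.
exact: unit_ball_volume_ge0.
Qed.

Lemma amplitude_ge0 : 0 <= amplitude.
Proof. by rewrite mulr_ge0 ?volume_factor_ge0// mulr_ge0// MJ_ge0. Qed.

Lemma influence_le_amplitude x y : `|2 * Jeps J eps (enorm (y - x))
    / (eps ^+ d.+1 * omega)| <= amplitude.
Proof.
rewrite ger0_norm; last first.
  by rewrite mulr_ge0 ?volume_factor_ge0// mulr_ge0// (influence_ge0 hJ).
by rewrite ler_wpM2r ?volume_factor_ge0// ler_wpM2l// JM.
Qed.

(** At distance r < eps the weaker singularities r^(-1/2) and, below, r^-1 are
    absorbed in r^(-3/2), at the cost of a power of eps. *)
Lemma inv_sqrt_le r : 0 <= r -> r < eps ->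
  (Num.sqrt r)^-1 <= eps * (r^-1 * (Num.sqrt r)^-1).
Proof.
rewrite le_eqVlt => /predU1P[<-|r0] re'; first by rewrite sqrtr0 !invr0 !mulr0.
rewrite mulrA -[leLHS]mul1r ler_wpM2r ?invr_ge0 ?sqrtr_ge0//.
by rewrite ler_pdivlMr// mul1r ltW.
Qed.

Lemma inv_le r : 0 <= r -> r < eps ->
  r^-1 <= Num.sqrt eps * (r^-1 * (Num.sqrt r)^-1).
Proof.
rewrite le_eqVlt => /predU1P[<-|r0] re'; first by rewrite sqrtr0 !invr0 !mulr0.
rewrite mulrCA -[leLHS]mulr1 ler_wpM2l ?invr_ge0 ?(ltW r0)//.
by rewrite ler_pdivlMr ?sqrtr_gt0// mul1r ler_wsqrtr// ltW.
Qed.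

Lemma force_density_bound u : measurable_fun setT u ->
  bond_density eps (amplitude * M1 * eps) (force_density u).
Proof.
move=> mu_; split=> [|x y xy]; first exact: joint_measurable_force_density.
rewrite force_densityE normrM -[leRHS]mulrA -[leRHS]mulrA.
apply: ler_pM => //; first exact: influence_le_amplitude.
rewrite normrM mulrC; apply: ler_pM => //.
by rewrite normfV ger0_norm ?sqrtr_ge0//; exact: inv_sqrt_le.
Qed.

Lemma dforce_density_bound u w c : measurable_fun setT u ->
  measurable_fun setT w -> (forall x, enorm (w x) <= c) ->
  bond_density eps (amplitude * M2 * (2 * c) * Num.sqrt eps) (dforce_density u w).
Proof.
move=> mu_ mw wc; split=> [|x y xy]; first exact: joint_measurable_dforce_density.
have c0 : 0 <= c by apply: le_trans (wc 0).
rewrite /dforce_density normrM normrM -mulrA.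
rewrite -[leRHS]mulrA -[leRHS]mulrA -[leRHS]mulrA.
apply: ler_pM; [by []|by rewrite mulr_ge0|exact: influence_le_amplitude|].
apply: ler_pM => //; first exact: gM2.
apply: le_trans (strain_le (wc x) (wc y)) _.
by rewrite ler_wpM2l ?mulr_ge0//; exact: inv_le.
Qed.

(** With a, b, s the scaled strains of u, v, u0 at distance r, the density is
    a bounded factor times r^(-1/2) (g'(a) - g'(b) - g''(s) (a - b)). Here |a
    - s| and |b - s| are at most r^(-1/2) 2 rho, and |a - b| is at most
    r^(-1/2) 2 c; altogether the singularity is r^(-3/2). *)
Lemma taylor_density_bound u0 u v rho c :
  measurable_fun setT u0 -> measurable_fun setT u -> measurable_fun setT v ->
  (forall x, enorm (u x - u0 x) <= rho) -> (forall x, enorm (v x - u0 x) <= rho) ->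
  (forall x, enorm (u x - v x) <= c) ->
  bond_density eps (amplitude * M3 * (2 * rho) * (2 * c))
    (fun x y => force_density u x y - force_density v x y
      - dforce_density u0 (u \- v) x y).
Proof.
move=> mu0 mu_ mv uB vB uvB; split=> [|x y xy].
  apply: measurable_funB; last first.
    by apply: joint_measurable_dforce_density => //; exact: measurable_subv.
  by apply: measurable_funB; exact: joint_measurable_force_density.
set r := enorm (y - x) in xy *.
have r0 : 0 <= r by exact: enorm_ge0.
have rho0 : 0 <= rho by apply: le_trans (uB 0).
have c0 : 0 <= c by apply: le_trans (uvB 0).
set a := scaled_strain y x u; set b := scaled_strain y x v.
set s := scaled_strain y x u0.
have sc w k : (forall x, enorm (w x) <= k) ->
    `|Num.sqrt r * strain y x w| <= Num.sqrt r * (2 * k * r^-1).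
  move=> wk; rewrite normrM ger0_norm ?sqrtr_ge0//.
  by rewrite ler_wpM2l ?sqrtr_ge0//; exact: strain_le.
have as_ : `|a - s| <= Num.sqrt r * (2 * rho * r^-1).
  by rewrite /a /s scaled_strainB; exact: sc.
have bs_ : `|b - s| <= Num.sqrt r * (2 * rho * r^-1).
  by rewrite /b /s scaled_strainB; exact: sc.
have ab_ : `|a - b| <= Num.sqrt r * (2 * c * r^-1).
  by rewrite /a /b scaled_strainB; exact: sc.
have h := linearization_error derivable_dg derivable_ddg gM3 as_ bs_.
have -> : force_density u x y - force_density v x y
      - dforce_density u0 (u \- v) x y =
    2 * Jeps J eps r / (eps ^+ d.+1 * omega) * ((Num.sqrt r)^-1 *
      (derive1 g a - derive1 g b - derive1 (derive1 g) s * (a - b))).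
  rewrite !force_densityE /dforce_density -/r -/a -/b -/s.
  rewrite /a /b scaled_strainB -/a -/b.
  have [rz|rn] := eqVneq r 0.
    rewrite rz sqrtr0 !(mulr0, invr0, mul0r) subr0 sub0r.
    by rewrite /strain -/r rz invr0 scale0r dotv0l mulr0 oppr0.
  have sn : Num.sqrt r != 0 by rewrite gt_eqF// sqrtr_gt0 lt0r rn r0.
  set k := (eps ^+ d.+1 * omega)^-1.
  rewrite [X in _ = _ * X]mulrBr (mulrCA _ _ (Num.sqrt r * _)) (mulKf sn).
  by rewrite /derive1n/=; ring.
rewrite normrM -[leRHS]mulrA -[leRHS]mulrA -[leRHS]mulrA.
apply: ler_pM => //; first exact: influence_le_amplitude.
rewrite normrM normfV (ger0_norm (sqrtr_ge0 _)).
apply: le_trans (ler_wpM2l _ h) _; first by rewrite invr_ge0 sqrtr_ge0.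
have [rz|rn] := eqVneq r 0.
  by rewrite rz sqrtr0 !(mulr0, invr0, mul0r).
have sn : Num.sqrt r != 0 by rewrite gt_eqF// sqrtr_gt0 lt0r rn r0.
apply: (@le_trans _ _ ((Num.sqrt r)^-1 * (M3 * (Num.sqrt r * (2 * rho / r)) *
    (Num.sqrt r * (2 * c / r))))).
  rewrite ler_wpM2l ?invr_ge0 ?sqrtr_ge0// ler_wpM2l//.
  by rewrite !mulr_ge0 ?M3_ge0 ?sqrtr_ge0 ?invr_ge0.
have rs : Num.sqrt r * Num.sqrt r = r by rewrite -expr2 sqr_sqrtr.
rewrite le_eqVlt; apply/orP; left; apply/eqP.
rewrite [LHS](_ : _ = M3 * (2 * rho) * (2 * c) * ((Num.sqrt r)^-1) *
   ((Num.sqrt r * Num.sqrt r) / r) / r); last by ring.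
by rewrite rs divff//; ring.
Qed.

End densities.

(** * The force operator on essentially bounded fields *)

Section restriction.
Context (R : realType) (d : nat).
Implicit Types (G : set 'rV[R]_d) (u v : 'rV[R]_d -> 'rV[R]_d) (c : R).

Lemma vrestrictB G u v : vrestrict G (u \- v) = vrestrict G u \- vrestrict G v.
Proof. by apply/funext => x; rewrite /vrestrict scalerBr. Qed.

Lemma vrestrict_bound G u c : 0 <= c -> (forall x, G x -> enorm (u x) <= c) ->
  forall x, enorm (vrestrict G u x) <= c.
Proof.
move=> c0 uc x; have [Gx|Gx] := pselect (G x).
  by rewrite vrestrict_in// uc.
by rewrite vrestrict_out// enorm0.
Qed.

Lemma vrestrictB_bound G u v c : 0 <= c ->
  (forall x, G x -> enorm (u x - v x) <= c) ->
  forall x, enorm (vrestrict G u x - vrestrict G v x) <= c.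
Proof.
by move=> c0 uv x; have := vrestrict_bound c0 uv x; rewrite (vrestrictB G u v).
Qed.

End restriction.

Section operators.
Context (R : realType) (d : nat) (J g : R -> R) (re rc eps : R).
Context (Om : set 'rV[R]_d).
Hypotheses (d2 : (2 <= d)%N).
Hypotheses (hJ : influence_function J) (hg : potential g re rc) (eps0 : 0 < eps).
Hypotheses (mOm : measurable Om) (bOm : bounded_set Om).
Local Notation mu := (lebesgue_rV R d).
Local Notation field := ('rV[R]_d -> 'rV[R]_d).
Local Notation ae_bounded := (ae_bounded Om).
Local Notation mass := (singular_mass d eps).
Local Notation amp MJ := (amplitude d eps MJ).
Implicit Types (x y : 'rV[R]_d) (u v w : field).

Let finOm : (mu Om < +oo)%E. Proof. exact: bounded_set_fin_measure. Qed.

Definition full_subset (G : set 'rV[R]_d) :=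
  [/\ measurable G, G `<=` Om & {ae mu, forall x, Om x -> G x}].

Lemma full_subset_refl : full_subset Om.
Proof. by split=> //; apply: aeW. Qed.

(** Modifying the field on a null set changes the force only on that null set,
    where the field itself enters the integrand at x. *)
Lemma force_restrict u G x : measurable_fun Om u -> full_subset G -> G x ->
  force J g Om eps u x = bond_op eps Om (force_density J g eps (vrestrict G u)) x.
Proof.
move=> mu_ [mG GO aeG] Gx; rewrite forceE.
have mV H : measurable H -> H `<=` Om ->
    joint_measurable (force_density J g eps (vrestrict H u)).
  move=> mH HO; apply: (joint_measurable_force_density hJ hg eps0).
  exact: (measurable_vrestrict mOm).
transitivity (bond_op eps Om (force_density J g eps (vrestrict Om u)) x).
  apply: eq_bond_op => y Oy.
  by apply: eq_force_density; rewrite vrestrict_in//; exact: GO.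
apply: bond_op_ae => //; [exact: mV|exact: mV|].
apply: filterS aeG => y + Oy => /(_ Oy) Gy.
by apply: eq_force_density; rewrite !vrestrict_in//; exact: GO.
Qed.

Lemma dforce_restrict u w G x : measurable_fun Om u -> measurable_fun Om w ->
  full_subset G -> G x -> dforce J g Om eps u w x =
    bond_op eps Om (dforce_density J g eps (vrestrict G u) (vrestrict G w)) x.
Proof.
move=> mu_ mw [mG GO aeG] Gx; rewrite dforceE.
have mV H : measurable H -> H `<=` Om -> joint_measurable
    (dforce_density J g eps (vrestrict H u) (vrestrict H w)).
  move=> mH HO; apply: (joint_measurable_dforce_density eps hJ hg);
  exact: (measurable_vrestrict mOm).
transitivity (bond_op eps Om
    (dforce_density J g eps (vrestrict Om u) (vrestrict Om w)) x).
  apply: eq_bond_op => y Oy.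
  by apply: eq_dforce_density; rewrite vrestrict_in//; exact: GO.
apply: bond_op_ae => //; [exact: mV|exact: mV|].
apply: filterS aeG => y + Oy => /(_ Oy) Gy.
by apply: eq_dforce_density; rewrite !vrestrict_in//; exact: GO.
Qed.

Lemma Vspace_bond_op c phi : 0 <= c -> bond_density eps c phi ->
  (forall x y, phi x y = phi y x) -> Vspace Om (bond_op eps Om phi).
Proof.
move=> c0 dphi phiC.
have [mb [M bM]] := bounded_measurable_bond_op d2 eps0 mOm finOm c0 dphi.
split.
  apply: (@ae_bounded_Linf _ _ _ _ `|M|) => //; first exact: measurable_funTS.
  by apply: aeW => x _; apply: le_trans (bM x) (ler_norm _).
by move=> w rw; exact: (bond_op_rigid d2 eps0 mOm finOm bOm c0 dphi phiC rw).
Qed.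

Variables MJ M1 M2 M3 : R.
Hypotheses (JM : forall r, J r <= MJ) (gM1 : forall r, `|derive1 g r| <= M1).
Hypotheses (gM2 : forall r, `|derive1 (derive1 g) r| <= M2).
Hypotheses (gM3 : forall r, `|derive1 (derive1 (derive1 g)) r| <= M3).

Let amp0 : 0 <= amp MJ. Proof. exact: (amplitude_ge0 d hJ eps0 JM). Qed.
Let M10 : 0 <= M1. Proof. exact: M1_ge0 gM1. Qed.
Let M20 : 0 <= M2. Proof. exact: M2_ge0 gM2. Qed.
Let M30 : 0 <= M3. Proof. exact: M3_ge0 gM3. Qed.

Lemma force_Vspace u : Linf Om u ->
  exists2 f, Vspace Om f & ae_same Om (force J g Om eps u) f.
Proof.
move=> [mu_ _].
exists (bond_op eps Om (force_density J g eps (vrestrict Om u))).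
  apply: (@Vspace_bond_op (amp MJ * M1 * eps)).
  - exact: mulr_ge0 (mulr_ge0 amp0 M10) (ltW eps0).
  - apply: force_density_bound => //; first exact: hg.
    exact: (measurable_vrestrict mOm).
  - by move=> x y; exact: force_densityC.
by apply: aeW => x Ox; apply: force_restrict => //; exact: full_subset_refl.
Qed.

(** The strain of w is of order c / r, which the singular kernel dominates;
    symmetry of the density gives the orthogonality to rigid motions. *)
Lemma dforce_bounded_Vspace u w c : Linf Om u -> Linf Om w -> 0 <= c ->
  ae_bounded w c -> exists2 f, Vspace Om f &
    ae_same Om (dforce J g Om eps u w) f /\
    ae_bounded f (d%:R * (amp MJ * M2 * 2 * Num.sqrt eps * mass) * c).
Proof.
move=> [mu_ _] [mw _] c0 wc.
have [G [mG GO Gc Gae]] := ae_full_set mOm wc.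
have Gfull : full_subset G by [].
have db : bond_density eps (amp MJ * M2 * (2 * c) * Num.sqrt eps)
    (dforce_density J g eps (vrestrict G u) (vrestrict G w)).
  apply: dforce_density_bound => //; first exact: hg.
  - exact: (measurable_vrestrict mOm).
  - exact: (measurable_vrestrict mOm).
  - exact: vrestrict_bound.
have k0 : 0 <= amp MJ * M2 * (2 * c) * Num.sqrt eps.
  apply: mulr_ge0 (sqrtr_ge0 _); apply: mulr_ge0 (mulr_ge0 amp0 M20) _.
  by rewrite mulr_ge0.
exists (bond_op eps Om (dforce_density J g eps (vrestrict G u) (vrestrict G w))).
  apply: (Vspace_bond_op k0 db).
  by move=> x y; exact: dforce_densityC.
split.
  by apply: filterS Gae => x Gx Ox; apply: dforce_restrict => //; exact: Gx.
apply: aeW => x _; apply: le_trans (bond_op_bound d2 eps0 mOm x k0 db) _.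
by rewrite le_eqVlt; apply/orP; left; apply/eqP; ring.
Qed.

(** The integral of the Taylor remainder of the bond forces. Its size comes
    from the mass eps^(d - 3/2) of the singular kernel divided by the factor
    eps^(d + 1) of the force, that is eps^(-5/2). *)
Lemma force_approx u0 u v rho c : Linf Om u0 -> Linf Om u -> Linf Om v ->
  0 <= rho -> 0 <= c ->
  ae_bounded (u \- u0) rho -> ae_bounded (v \- u0) rho ->
  ae_bounded (u \- v) c ->
  ae_bounded (fun x => force J g Om eps u x - force J g Om eps v x
      - dforce J g Om eps u0 (u \- v) x)
    (d%:R * (amp MJ * M3 * (2 * rho) * 2 * mass) * c).
Proof.
move=> u0L uL vL rho0 c0 uB vB uvB.
have mu0 := u0L.1; have mu_ := uL.1; have mv := vL.1.
have close : {ae mu, forall x, Om x -> [/\ enorm (u x - u0 x) <= rho,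
    enorm (v x - u0 x) <= rho & enorm (u x - v x) <= c]}.
  apply: filterS3 uB vB uvB => x h1 h2 h3 Ox.
  by split; [exact: h1|exact: h2|exact: h3].
have [G [mG GO GP Gae]] := ae_full_set mOm close.
have Gfull : full_subset G by [].
have mr f : measurable_fun Om f -> measurable_fun setT (vrestrict G f).
  exact: (measurable_vrestrict mOm).
have db := taylor_density_bound hJ hg eps0 JM gM3 (mr _ mu0) (mr _ mu_) (mr _ mv)
  (vrestrictB_bound rho0 (fun x Gx => let: And3 h _ _ := GP x Gx in h))
  (vrestrictB_bound rho0 (fun x Gx => let: And3 _ h _ := GP x Gx in h))
  (vrestrictB_bound c0 (fun x Gx => let: And3 _ _ h := GP x Gx in h)).
have fb f : measurable_fun Om f -> bond_density eps (amp MJ * M1 * eps)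
    (force_density J g eps (vrestrict G f)).
  by move=> mf; exact: (force_density_bound hJ hg eps0 JM gM1 (mr _ mf)).
have ddb : bond_density eps (amp MJ * M2 * (2 * c) * Num.sqrt eps)
    (dforce_density J g eps (vrestrict G u0) (vrestrict G u \- vrestrict G v)).
  apply: (dforce_density_bound hJ hg eps0 JM gM2 (mr _ mu0)).
    by apply: measurable_subv; exact: mr.
  by apply: vrestrictB_bound => // x /GP[].
have k0 : 0 <= amp MJ * M3 * (2 * rho) * (2 * c).
  by apply: mulr_ge0; [apply: mulr_ge0 (mulr_ge0 amp0 M30) _|]; rewrite mulr_ge0.
apply: filterS Gae => x Gx /Gx {}Gx.
rewrite (force_restrict mu_ Gfull Gx) (force_restrict mv Gfull Gx).
rewrite (dforce_restrict mu0 _ Gfull Gx); last exact: (measurable_fun_subv mOm).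
rewrite vrestrictB (bond_opB d2 eps0 mOm x (fb _ mu_) (fb _ mv)).
rewrite (bond_opB d2 eps0 mOm x (bond_densityB (fb _ mu_) (fb _ mv)) ddb).
apply: le_trans (bond_op_bound d2 eps0 mOm x k0 db) _.
by rewrite le_eqVlt; apply/orP; left; apply/eqP; ring.
Qed.

End operators.

(** * Convexity of the energy in the strength domain *)

Section ae_integrals.
Context disp (T : measurableType disp) (R : realType).
Variable nu : {measure set T -> \bar R}.
Implicit Types (D : set T) (f h : T -> R).

Lemma ae_eq_Rintegral D f h : measurable D -> measurable_fun D f ->
  measurable_fun D h -> {ae nu, forall x, D x -> f x = h x} ->
  \int[nu]_(x in D) f x = \int[nu]_(x in D) h x.
Proof.
move=> mD mf mh fh; congr fine; apply: ae_eq_integral => //.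
- exact/measurable_EFinP.
- exact/measurable_EFinP.
- by apply: filterS fh => x e Dx; rewrite e.
Qed.

Lemma ae_Rintegral_ge0 D f : measurable D -> measurable_fun D f ->
  {ae nu, forall x, D x -> 0 <= f x} -> 0 <= \int[nu]_(x in D) f x.
Proof.
move=> mD mf f0; rewrite (@ae_eq_Rintegral _ _ (fun x => Num.max (f x) 0)) //.
- by apply: Rintegral_ge0 => x _; rewrite le_max lexx orbT.
- exact: measurable_maxr.
- by apply: filterS f0 => x h Dx; rewrite max_l// h.
Qed.

Lemma ae_le_Rintegral D f h : measurable D -> nu.-integrable D (EFin \o f) ->
  nu.-integrable D (EFin \o h) -> {ae nu, forall x, D x -> f x <= h x} ->
  \int[nu]_(x in D) f x <= \int[nu]_(x in D) h x.
Proof.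
move=> mD intf inth fh; rewrite -subr_ge0 -RintegralB//.
apply: ae_Rintegral_ge0 => //.
  apply: measurable_funB; apply/measurable_EFinP.
    exact: (measurable_int _ inth).
  exact: (measurable_int _ intf).
by apply: filterS fh => x h' Dx; rewrite subr_ge0 h'.
Qed.

End ae_integrals.

Section energy.
Context (R : realType) (d : nat) (J g : R -> R) (re rc eps : R).
Context (Om : set 'rV[R]_d).
Hypotheses (d2 : (2 <= d)%N).
Hypotheses (hJ : influence_function J) (hg : potential g re rc) (eps0 : 0 < eps).
Hypotheses (mOm : measurable Om) (bOm : bounded_set Om).
Local Notation mu := (lebesgue_rV R d).
Local Notation field := ('rV[R]_d -> 'rV[R]_d).
Local Notation ae_bounded := (ae_bounded Om).
Local Notation mass := (singular_mass d eps).
Local Notation amp MJ := (amplitude d eps MJ).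
Local Notation omega := (unit_ball_volume R d).
Local Notation full_subset := (full_subset Om).
Implicit Types (x y : 'rV[R]_d) (u v w : field).

Let finOm : (mu Om < +oo)%E. Proof. exact: bounded_set_fin_measure. Qed.

(** The contribution of a bond to the energy; it is half of the primitive of
    its contribution to the force, as each bond is counted from both ends. *)
Definition bond_energy u x y : R := enorm (y - x) * energy_density J g eps y x u.

Lemma bond_energyE u x y : bond_energy u x y =
  2 * Jeps J eps (enorm (y - x)) / (eps ^+ d.+1 * omega) *
  (2^-1 * (enorm (y - x) / enorm (y - x)) * g (scaled_strain y x u)).
Proof.
rewrite /bond_energy /energy_density invfM.
set r := enorm _; set E := (eps ^+ d.+1 * omega)^-1.
rewrite [RHS](_ : _ = 2 / 2 * (r * (Jeps J eps r * (E / r) *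
  g (scaled_strain y x u)))); last by ring.
by rewrite divff ?mul1r// pnatr_eq0.
Qed.

Lemma eq_bond_energy u v x y : u x = v x -> u y = v y ->
  bond_energy u x y = bond_energy v x y.
Proof.
move=> ux uy.
by rewrite /bond_energy /energy_density (eq_scaled_strain ux uy).
Qed.

Lemma PDE u : PD J g Om eps u =
  \int[mu]_(x in Om) \int[mu]_(y in Om) horizon_cut eps (bond_energy u) x y.
Proof. by apply: eq_Rintegral => x _; rewrite -horizon_cut_Rintegral. Qed.

Variables MJ M0 M1 : R.
Hypotheses (JM : forall r, J r <= MJ) (gM0 : forall r, `|g r| <= M0).
Hypotheses (gM1 : forall r, `|derive1 g r| <= M1).

Let amp0 : 0 <= amp MJ. Proof. exact: (amplitude_ge0 d hJ eps0 JM). Qed.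
Let M00 : 0 <= M0. Proof. exact: le_trans (normr_ge0 _) (gM0 0). Qed.
Let M10 : 0 <= M1. Proof. exact: M1_ge0 gM1. Qed.

Let cE := amp MJ * (M0 * (eps * Num.sqrt eps)).
Let cE0 : 0 <= cE.
Proof.
apply: mulr_ge0 amp0 _; apply: mulr_ge0 M00 _.
by rewrite mulr_ge0 ?sqrtr_ge0// ltW.
Qed.

Lemma bond_energy_bound u : measurable_fun setT u ->
  bond_density eps cE (bond_energy u).
Proof.
move=> mu_; split=> [|x y xy].
  apply: measurable_funM; first exact: measurable_distance.
  apply: measurable_funM; last first.
    apply: (measurableT_comp (measurable_derivable (derivable_g hg))).
    exact: joint_measurable_scaled_strain.
  apply: measurable_funM; first exact: joint_measurable_Jeps.
  apply: measurable_invr_ge0.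
    move=> z; rewrite !mulr_ge0 ?exprn_ge0 ?(ltW eps0)//.
    exact: unit_ball_volume_ge0.
  by apply: measurable_funM => //; exact: measurable_distance.
rewrite bond_energyE normrM /cE -[leRHS]mulrA; apply: ler_pM => //.
  exact: influence_le_amplitude.
set r := enorm (y - x) in xy *.
have r0 : 0 <= r by exact: enorm_ge0.
have [rz|rn] := eqVneq r 0.
  by rewrite rz mul0r mulr0 mul0r normr0 invr0 !(mul0r, mulr0).
rewrite divff// mulr1 normrM mulrC -[leRHS]mulrA; apply: ler_pM => //.
have rp : 0 < r by rewrite lt0r rn r0.
have sp : 0 < Num.sqrt r by rewrite sqrtr_gt0.
rewrite ger0_norm ?invr_ge0//.
rewrite [leRHS](_ : _ = (eps / r) * (Num.sqrt eps / Num.sqrt r)); last by ring.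
apply: (@le_trans _ _ (1 * 1)); first by rewrite mulr1 invf_le1// ler1n.
apply: ler_pM => //; first by rewrite ler_pdivlMr// mul1r ltW.
by rewrite ler_pdivlMr// mul1r ler_wsqrtr// ltW.
Qed.

Lemma PD_restrict u G : measurable_fun Om u -> full_subset G ->
  PD J g Om eps u = PD J g Om eps (vrestrict G u).
Proof.
move=> mu_ [mG GO aeG].
have mr H : measurable H -> H `<=` Om -> measurable_fun setT (vrestrict H u).
  by move=> mH HO; exact: (measurable_vrestrict mOm).
have db H : measurable H -> H `<=` Om -> dominated eps cE
    (horizon_cut eps (bond_energy (vrestrict H u))).
  move=> mH HO; apply: dominated_bond_density.
  exact: bond_energy_bound (mr H mH HO).
transitivity (PD J g Om eps (vrestrict Om u)); rewrite !PDE.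
  apply: eq_Rintegral => x /set_mem Ox; apply: eq_Rintegral => y /set_mem Oy.
  rewrite /horizon_cut; case: ifPn => // _.
  by apply: eq_bond_energy; rewrite vrestrict_in.
have dO := db Om mOm (@subset_refl _ Om); have dG := db G mG GO.
apply: ae_eq_Rintegral => //.
- apply: measurable_funTS.
  exact: (measurable_dominated_Rintegral d2 eps0 mOm finOm cE0 dO).
- apply: measurable_funTS.
  exact: (measurable_dominated_Rintegral d2 eps0 mOm finOm cE0 dG).
apply: filterS (aeG) => x Gx Ox.
apply: ae_eq_Rintegral => //.
- by apply: measurable_funTS; apply: joint_measurable_section; exact: dO.1.
- by apply: measurable_funTS; apply: joint_measurable_section; exact: dG.1.
apply: filterS aeG => y Gy Oy; rewrite /horizon_cut; case: ifPn => // _.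
by apply: eq_bond_energy; rewrite !vrestrict_in//; [exact: Gx|exact: Gy].
Qed.

(** The potential is convex between re and rc, so that the energy of a bond
    lies above its tangent at u0, whose slope is the bond force. *)
Lemma bond_energy_convex u0 u x y :
  re < scaled_strain y x u0 < rc -> re < scaled_strain y x u < rc ->
  2^-1 * (force_density J g eps u0 x y *
    dotv ((u \- u0) y - (u \- u0) x) (direction y x)) <=
  bond_energy u x y - bond_energy u0 x y.
Proof.
move=> s0I sI; set r := enorm (y - x).
have r0 : 0 <= r by exact: enorm_ge0.
have [rz|rn] := eqVneq r 0.
  by rewrite !bond_energyE force_densityE -/r rz sqrtr0 invr0 !(mul0r, mulr0) subrr.
have rp : 0 < r by rewrite lt0r rn r0.
have sn : Num.sqrt r != 0 by rewrite gt_eqF// sqrtr_gt0.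
have := convex_tangent (derivable_g hg) (derivable_dg hg)
  (fun z zI => ltW (potential_convex_strict hg zI)) s0I sI.
rewrite scaled_strainB -/r /strain dotvZl -/r => h.
rewrite !bond_energyE force_densityE -/r divff// -mulrBr.
rewrite [leLHS](_ : _ = 2 * Jeps J eps r / (eps ^+ d.+1 * omega) * (2^-1 *
  (derive1 g (scaled_strain y x u0) * (Num.sqrt r * (r^-1 *
    dotv ((u \- u0) y - (u \- u0) x) (direction y x)))))).
  rewrite ler_wpM2l; last 2 first.
  - rewrite mulr_ge0 ?(volume_factor_ge0 d eps0)// mulr_ge0//.
    exact: (influence_ge0 hJ).
  - by rewrite mulr1 -mulrBr ler_wpM2l.
  - by [].
have -> : r^-1 = (Num.sqrt r)^-1 * (Num.sqrt r)^-1.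
  by rewrite -invfM -expr2 sqr_sqrtr.
by rewrite -[_^-1 / _ * dotv _ _]mulrA mulVKf//; ring.
Qed.

Definition bond_work u w x y : R := horizon_cut eps (fun x y =>
  force_density J g eps u x y * dotv (w y - w x) (direction y x)) x y.

Lemma dominated_bond_work u w : measurable_fun setT u -> bounded_measurable w ->
  exists2 c, 0 <= c & dominated eps c (bond_work u w).
Proof.
move=> mu_ [mw [M wM]].
have db := force_density_bound hJ hg eps0 JM gM1 mu_.
have c0 : 0 <= amp MJ * M1 * eps by exact: mulr_ge0 (mulr_ge0 amp0 M10) (ltW eps0).
have M0' : 0 <= 2 * M by rewrite mulr_ge0// (le_trans _ (wM 0)).
exists (amp MJ * M1 * eps * (2 * M)); first exact: mulr_ge0.
apply: dominated_horizon_cut => //.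
  apply: measurable_dotv; last exact: measurable_direction.
  by apply: measurable_subv; exact: (measurableT_comp mw).
move=> x y; apply: le_trans (cauchy_schwarz _ _) _; rewrite -[leRHS]mulr1.
apply: ler_pM => //; last exact: enorm_direction_le1.
apply: le_trans (enormD _ _) _; rewrite enormN.
by rewrite mulr_natl mulr2n lerD.
Qed.

(** The double integral of the tangents to the bond energies is the work of
    the force field, by the weak form of the force operator. *)
Lemma bond_op_weak_force u w : measurable_fun setT u -> bounded_measurable w ->
  \int[mu]_(x in Om) \int[mu]_(y in Om) (2^-1 * bond_work u w x y) =
  \int[mu]_(x in Om) dotv (bond_op eps Om (force_density J g eps u) x) (w x).
Proof.
move=> mu_ bw.
have db := force_density_bound hJ hg eps0 JM gM1 mu_.
have c0 : 0 <= amp MJ * M1 * eps by exact: mulr_ge0 (mulr_ge0 amp0 M10) (ltW eps0).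
rewrite (bond_op_weak d2 eps0 mOm finOm c0 db (force_densityC J g eps u) bw).
have [c k0 dk] := dominated_bond_work mu_ bw.
have ik := integrable_dominated_Rintegral d2 eps0 mOm finOm k0 dk.
have cutE x : \int[mu]_(y in eball x eps `&` Om)
    (force_density J g eps u x y * dotv (w y - w x) (direction y x)) =
    \int[mu]_(y in Om) bond_work u w x y.
  exact: (horizon_cut_Rintegral eps Om (fun x y =>
    force_density J g eps u x y * dotv (w y - w x) (direction y x))).
under [X in _ = _ * X]eq_Rintegral do rewrite cutE.
rewrite -RintegralZl//; apply: eq_Rintegral => x _.
by rewrite -RintegralZl//; exact: (dominated_integrable d2 eps0 mOm x dk).
Qed.

End energy.

Section minimality.
Context (R : realType) (d : nat) (J g : R -> R) (re rc eps : R).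
Context (Om : set 'rV[R]_d).
Hypotheses (d2 : (2 <= d)%N).
Hypotheses (hJ : influence_function J) (hg : potential g re rc) (eps0 : 0 < eps).
Hypotheses (mOm : measurable Om) (bOm : bounded_set Om).
Local Notation mu := (lebesgue_rV R d).
Local Notation field := ('rV[R]_d -> 'rV[R]_d).
Implicit Types (x y : 'rV[R]_d) (u v w b : field).

Let finOm : (mu Om < +oo)%E. Proof. exact: bounded_set_fin_measure. Qed.

Lemma measurable_fun_dotv u b : measurable_fun Om u -> measurable_fun Om b ->
  measurable_fun Om (fun x => dotv (u x) (b x)).
Proof.
move=> mu_ mb; apply: (@eq_measurable_fun _ _ _ _ _
    (fun x => dotv (vrestrict Om u x) (vrestrict Om b x))).
  by move=> x /set_mem Ox; rewrite !vrestrict_in.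
apply: measurable_funTS.
by apply: measurable_dotv; exact: (measurable_vrestrict mOm).
Qed.

Variables MJ M0 M1 : R.
Hypotheses (JM : forall r, J r <= MJ) (gM0 : forall r, `|g r| <= M0).
Hypotheses (gM1 : forall r, `|derive1 g r| <= M1).

(** Summed over all bonds, the tangent inequality says that the energy PD
    exceeds its value at u0 by at least the work of the force of u0 in u - u0.
    At a critical point this force is b, and the work is exactly the change of
    the load term. *)
Lemma critical_point_minimizes u0 u b : Linf Om u0 -> Linf Om u -> Linf Om b ->
  strength_domain Om eps re rc u0 -> strength_domain Om eps re rc u ->
  critical_point J g Om eps b u0 ->
  energy J g Om eps b u0 <= energy J g Om eps b u.
Proof.
move=> u0L uL bL sd0 sd crit.
have mu0 := u0L.1; have mu_ := uL.1; have mb := bL.1.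
have bounds : {ae mu, forall x, Om x -> [/\ enorm (u0 x) <= Linf_size Om u0,
    enorm (u x) <= Linf_size Om u & enorm (b x) <= Linf_size Om b]}.
  apply: filterS3 (ae_bounded_size u0L) (ae_bounded_size uL) (ae_bounded_size bL).
  move=> x h1 h2 h3 Ox.
  by split; [exact: h1|exact: h2|exact: h3].
have good : {ae mu, forall x, Om x ->
    [/\ [/\ enorm (u0 x) <= Linf_size Om u0,
      enorm (u x) <= Linf_size Om u & enorm (b x) <= Linf_size Om b],
    force J g Om eps u0 x = b x &
    {ae mu, forall y, (eball x eps `&` Om) y ->
      re < scaled_strain y x u0 < rc /\ re < scaled_strain y x u < rc}]}.
  have strains : {ae mu, forall x, Om x ->
      {ae mu, forall y, (eball x eps `&` Om) y ->
      re < scaled_strain y x u0 < rc /\ re < scaled_strain y x u < rc}}.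
    apply: filterS2 sd0 sd => x h3 h4 Ox.
    apply: filterS2 (h3 Ox) (h4 Ox) => y h5 h6 Oy.
    by split; [exact: h5|exact: h6].
  apply: filterS3 bounds crit strains => x h1 h2 h3 Ox.
  by split; [exact: h1|exact: h2|exact: h3].
have [G [mG GO GP Gae]] := ae_full_set mOm good.
have Gfull : full_subset Om G by [].
have mr f : measurable_fun Om f -> measurable_fun setT (vrestrict G f).
  exact: (measurable_vrestrict mOm).
have vb f c : 0 <= c -> (forall x, G x -> enorm (f x) <= c) ->
    forall x, enorm (vrestrict G f x) <= c by exact: vrestrict_bound.
have b0 x : enorm (vrestrict G u0 x) <= Linf_size Om u0.
  by apply: vb; [exact: Linf_size_ge0|move=> z /GP[[]]].
have b1 x : enorm (vrestrict G u x) <= Linf_size Om u.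
  by apply: vb; [exact: Linf_size_ge0|move=> z /GP[[]]].
have b2 x : enorm (vrestrict G b x) <= Linf_size Om b.
  by apply: vb; [exact: Linf_size_ge0|move=> z /GP[[]]].
pose w := vrestrict G u \- vrestrict G u0.
have bw : bounded_measurable w.
  split; first by apply: measurable_subv; exact: mr.
  exists (Linf_size Om u + Linf_size Om u0) => x.
  by apply: le_trans (enormD _ _) _; rewrite enormN lerD.
have work f : measurable_fun Om f ->
    \int[mu]_(x in Om) dotv (f x) (b x) =
    \int[mu]_(x in Om) dotv (vrestrict G f x) (vrestrict G b x).
  move=> mf; apply: ae_eq_Rintegral => //; first exact: measurable_fun_dotv.
    by apply: measurable_funTS; apply: measurable_dotv; exact: mr.
  by apply: filterS Gae => x Gx Ox; rewrite !vrestrict_in//; exact: Gx.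
have workI f c : 0 <= c -> measurable_fun Om f ->
    (forall x, enorm (vrestrict G f x) <= c) ->
    mu.-integrable Om (EFin \o
      (fun x => dotv (vrestrict G f x) (vrestrict G b x))).
  move=> c0 mf fc; have [] // := dotv_integral mOm bOm c0 (Linf_size_ge0 Om b)
    (measurable_funTS (mr _ mf)) _ (mr _ mb) (fun x _ => b2 x).
  by apply: aeW => x _; exact: fc.
rewrite /energy (PD_restrict d2 hJ hg eps0 mOm bOm JM gM0 mu_ Gfull).
rewrite (PD_restrict d2 hJ hg eps0 mOm bOm JM gM0 mu0 Gfull).
rewrite !work//.
have sub_le (p q r s : R) : r - s <= p - q -> q - s <= p - r by lra.
apply: sub_le; set u0' := vrestrict G u0; set u' := vrestrict G u.
rewrite -RintegralB//; last 2 first.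
- exact: workI (Linf_size_ge0 _ _) mu_ b1.
- exact: workI (Linf_size_ge0 _ _) mu0 b0.
rewrite (@ae_eq_Rintegral _ _ _ _ _ _ (fun x =>
    dotv (bond_op eps Om (force_density J g eps u0') x) (w x))) //; last 3 first.
- apply: measurable_funB; apply: measurable_funTS;
    by apply: measurable_dotv; exact: mr.
- apply: measurable_funTS; apply: measurable_dotv; last exact: bw.1.
  have M10 := M1_ge0 gM1.
  apply: (measurable_bond_op d2 eps0 mOm finOm _
    (force_density_bound hJ hg eps0 JM gM1 (mr _ mu0))).
  by apply: mulr_ge0 (ltW eps0); apply: mulr_ge0 M10; exact: amplitude_ge0 JM.
- apply: filterS Gae => x Gx /Gx {}Gx; have [_ fb _] := GP x Gx.
  rewrite -(force_restrict hJ hg eps0 mOm mu0 Gfull Gx) fb -dotvBl dotvC.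
  by rewrite vrestrict_in.
rewrite -(bond_op_weak_force d2 hJ hg eps0 mOm bOm JM gM1 (mr _ mu0) bw).
have [c c0 dk] := dominated_bond_work hJ hg eps0 JM gM1 (mr _ mu0) bw.
have dk2 : dominated eps (2^-1 * c) (fun x y => 2^-1 * bond_work J g eps u0' w x y).
  exact: dominatedZ.
have c20 : 0 <= 2^-1 * c by rewrite mulr_ge0.
have M00 : 0 <= M0 by exact: le_trans (normr_ge0 _) (gM0 0).
have dE f : measurable_fun Om f -> exists2 a, 0 <= a &
    dominated eps a (horizon_cut eps (bond_energy J g eps (vrestrict G f))).
  move=> mf; eexists; last first.
    apply: dominated_bond_density.
    exact: (bond_energy_bound hJ hg eps0 JM gM0 (mr _ mf)).
  apply: mulr_ge0; first exact: amplitude_ge0 JM.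
  by apply: mulr_ge0 M00 _; rewrite mulr_ge0 ?sqrtr_ge0// ltW.
have [a a0 dkE] := dE u mu_; have [a' a'0 dkE0] := dE u0 mu0.
have iE := integrable_dominated_Rintegral d2 eps0 mOm finOm a0 dkE.
have iE0 := integrable_dominated_Rintegral d2 eps0 mOm finOm a'0 dkE0.
have iW := integrable_dominated_Rintegral d2 eps0 mOm finOm c20 dk2.
rewrite (PDE J g eps Om u') (PDE J g eps Om u0') -(RintegralB mOm iE iE0).
apply: ae_le_Rintegral => //; first exact: (integrableB mOm iE iE0).
apply: filterS (Gae) => x Gx /Gx {}Gx; have [_ _ strains] := GP x Gx.
have jE := dominated_integrable d2 eps0 mOm x dkE.
have jE0 := dominated_integrable d2 eps0 mOm x dkE0.
have jW := dominated_integrable d2 eps0 mOm x dk2.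
rewrite -(RintegralB mOm jE jE0).
apply: ae_le_Rintegral => //; first exact: (integrableB mOm jE jE0).
apply: filterS2 Gae strains => y Gy xy_strains Oy.
rewrite /bond_work /horizon_cut; case: ifPn => xy; last by rewrite mulr0 subrr.
have [s0I sI] := xy_strains (conj xy Oy); have {}Gy := Gy Oy.
apply: (bond_energy_convex hJ hg eps0).
- by rewrite (@eq_scaled_strain _ _ _ u0)// vrestrict_in.
- by rewrite (@eq_scaled_strain _ _ _ u)// vrestrict_in.
Qed.

End minimality.

(** * Equilibria along a load path *)

Lemma powR_five_halves (R : realType) (eps : R) : 0 < eps ->
  eps `^ (5 / 2) = eps ^+ 2 * Num.sqrt eps.
Proof.
move=> e0; rewrite (_ : 5 / 2 = 2 + 2^-1); last by field.
by rewrite powRD ?gt_eqF ?implybT// powR_mulrn ?(ltW e0)// powR12_sqrt// ltW.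
Qed.

Theorem theorem5 (R : realType) (d : nat) (hd : d = 2%N \/ d = 3%N)
    (J g : R -> R) (re rc : R)
    (hJ : influence_function J) (hg : potential g re rc) :
  exists C : R, 0 < C /\
  forall (Om : set 'rV[R]_d) (eps : R) (u0 b0 : 'rV[R]_d -> 'rV[R]_d),
    bounded_domain Om -> interior_cone_condition Om -> 0 < eps ->
    Vspace Om u0 -> Vspace Om b0 ->
    strictly_in_strength_domain Om eps re rc u0 ->
    critical_point J g Om eps b0 u0 ->
    boundedly_invertible Om (dforce J g Om eps u0) ->
    let N := inverse_norm Om (dforce J g Om eps u0) in
    let rad := C * (eps `^ (5 / 2)) / N in
    (forall (T : R) (b : R -> 'rV[R]_d -> 'rV[R]_d),
        0 <= T ->
        (forall t, 0 <= t <= T ->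
           Vspace Om (b t) /\ Linf_ball Om b0 (rad / (2 * N)) (b t)) ->
        continuous_path Om T b ->
        exists u, solution_path J g Om eps u0 rad T b u /\
          forall v, solution_path J g Om eps u0 rad T b v ->
            forall t, 0 <= t <= T -> ae_same Om (v t) (u t)) /\
    (forall u, Linf_ball Om u0 rad u -> strength_domain Om eps re rc u ->
       energy J g Om eps b0 u0 <= energy J g Om eps b0 u).
Proof.
have d2 : (2 <= d)%N by case: hd => ->.
have [MJ JM] := influence_bounded hJ.
have [M0 gM0] := potential_bounded hg (n := 0) isT.
have [M1 gM1] := potential_bounded hg (n := 1) isT.
have [M2 gM2] := potential_bounded hg (n := 2) isT.
have [M3 gM3] := potential_bounded hg (n := 3) isT.
(* The Lipschitz constant of the derivative of the force operator is C1 /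
   eps^(5/2), see kappaE below; the choice of C makes N * kappa, which is C1 *
   C, at most 1/2. *)
pose C1 := d%:R * (2 * MJ / unit_ball_volume R d * M3 * 2 * 2 * (16 * 2 ^+ d)).
have C10 : 0 <= C1.
  have MJ0 := MJ_ge0 hJ JM; have M30 := M3_ge0 gM3.
  have om0 := unit_ball_volume_ge0 R d.
  by rewrite /C1 !mulr_ge0 ?invr_ge0 ?exprn_ge0.
exists (2 * (C1 + 1))^-1; split.
  by rewrite invr_gt0 mulr_gt0// ltr_pwDr.
set C := (2 * (C1 + 1))^-1.
move=> Om eps u0 b0 [_ oOm _ bOm] _ eps0 Vu0 Vb0 str crit Ainv N rad.
have mOm := open_measurable_rV oOm.
have u0L := Vspace_Linf Vu0.
split; last first.
  move=> u [uL _] sd.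
  apply: (critical_point_minimizes d2 hJ hg eps0 mOm bOm JM gM0 gM1) => //.
    exact: Vspace_Linf.
  have [a [b [rea brc ab]]] := str.
  apply: filterS ab => x h Ox; apply: filterS (h Ox) => y k Oy.
  by have /andP[? ?] := k Oy; apply/andP; split; lra.
pose F := force J g Om eps; pose A := dforce J g Om eps u0.
have E0 : 0 < eps `^ (5 / 2) by rewrite powR_gt0.
have AV w : Vspace Om w -> exists2 f, Vspace Om f & ae_same Om (A w) f.
  move=> Vw; have wL := Vspace_Linf Vw.
  have [f Vf [fA _]] := dforce_bounded_Vspace d2 hJ hg eps0 mOm bOm JM gM2 u0L wL
    (Linf_size_ge0 Om w) (ae_bounded_size wL).
  by exists f.
have N0 : 0 <= N := inverse_norm_ge0 Ainv.
have rad0 : 0 <= rad.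
  by rewrite !mulr_ge0 ?invr_ge0// ?(ltW E0)// mulr_ge0// addr_ge0.
pose kappa := C1 * rad / eps `^ (5 / 2).
have kappa0 : 0 <= kappa := divr_ge0 (mulr_ge0 C10 rad0) (ltW E0).
have Nkappa : N * kappa <= 2^-1.
  (* If N is 0, then rad is 0 as well, as the inverse of 0 is 0; the ball is
     reduced to u0 and the estimates persist. *)
  have [Nz|Nn] := eqVneq N 0; first by rewrite Nz mul0r invr_ge0.
  rewrite (_ : N * kappa = C1 / (2 * (C1 + 1))).
    by rewrite invfM mulrCA ler_piMr ?invr_ge0// ler_pdivrMr ?mul1r; lra.
  rewrite /kappa /rad /C; field.
  by rewrite Nn !gt_eqF// ltr_pwDr.
pose rho := rad / (2 * N).
have rho0 : 0 <= rho by rewrite divr_ge0// mulr_ge0.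
have Nrho : N * rho <= rad / 2.
  have [Nz|Nn] := eqVneq N 0; first by rewrite Nz mul0r divr_ge0.
  by rewrite /rho le_eqVlt; apply/orP; left; apply/eqP; field.
have FV u : Vspace Om u -> exists2 f, Vspace Om f & ae_same Om (F u) f.
  by move=> Vu; apply: (force_Vspace d2 hJ hg eps0 mOm bOm JM gM1 (Vspace_Linf Vu)).
have [A_onto _ _] := Ainv.
have A_inv := inverse_norm_bound Ainv AV.
pose K := d%:R * (amplitude d eps MJ * M2 * 2 * Num.sqrt eps * singular_mass d eps).
have A_bounded w c : Vspace Om w -> 0 <= c -> ae_bounded Om w c ->
    ae_bounded Om (A w) (K * c).
  move=> Vw c0 wc; have wL := Vspace_Linf Vw.
  have [f Vf [fA fc]] := dforce_bounded_Vspace d2 hJ hg eps0 mOm bOm JM gM2 u0L wL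
    c0 wc.
  exact: ae_bounded_same (ae_same_sym fA) fc.
have kappaE : d%:R * (amplitude d eps MJ * M3 * (2 * rad) * 2 * singular_mass d eps)
    = kappa.
  rewrite /kappa powR_five_halves// /C1 /amplitude /singular_mass.
  rewrite [eps ^+ d.+1]exprS.
  rewrite !invfM; set s := (Num.sqrt eps)^-1; set o := (unit_ball_volume R d)^-1.
  have ed : eps ^+ d * (eps ^+ d)^-1 = 1 by rewrite divff// expf_neq0// gt_eqF.
  rewrite [LHS](_ : _ = d%:R * (2 * MJ * o * M3 * 2 * 2 * (16 * 2 ^+ d)) * rad *
    (eps^-1 * eps^-1 * s) * (eps ^+ d * (eps ^+ d)^-1)); last by ring.
  by rewrite ed mulr1; ring.
have F_approx u v c : Vspace Om u -> Vspace Om v -> 0 <= c ->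
    ae_bounded Om (u \- u0) rad -> ae_bounded Om (v \- u0) rad ->
    ae_bounded Om (u \- v) c ->
    ae_bounded Om (fun x => F u x - F v x - A (u \- v) x) (kappa * c).
  move=> Vu Vv c0 uB vB uvB; rewrite -kappaE.
  exact: (force_approx d2 hJ hg eps0 mOm JM gM1 gM2 gM3 u0L (Vspace_Linf Vu)
    (Vspace_Linf Vv) rad0 c0 uB vB uvB).
have stable := newton_stability mOm bOm N0 kappa0 Nkappa A_inv F_approx.
have solve := newton_solution mOm bOm kappa0 rad0 Nkappa Vu0 FV A_onto A_inv
  A_bounded F_approx rho0 Nrho crit.
move=> T b T0 bV bC.
have ballP r u v : 0 <= r -> Linf_ball Om v r u -> ae_bounded Om (u \- v) r.
  by move=> r0 [_ /(Linf_norm_leP _ _ r0)].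
have /choice[u uP] t : exists v, 0 <= t <= T -> [/\ Vspace Om v,
    ae_bounded Om (v \- u0) rad & ae_same Om (F v) (b t)].
  have [tT|] := boolP (0 <= t <= T); last by exists u0.
  have [Vb bB] := bV t tT.
  have [v Vv [vB Fv]] := solve (b t) Vb (ballP _ _ _ rho0 bB).
  by exists v.
exists u; split.
  split=> [t tT|t tT|t tT]; last by have [] := uP t tT.
    have [Vu uB _] := uP t tT; split=> //; split; first exact: Vspace_Linf.
    exact/Linf_norm_leP.
  apply: (@squeeze_cvge _ _ _ _ (cst 0%E) _
      (fun s => (2 * N)%:E * Linf_norm Om (b s \- b t)%R)%E).
  - rewrite near_withinE; near=> s => sT.
    rewrite Linf_norm_ge0/=.
    have [Vus usB Fus] := uP s sT; have [Vut utB Fut] := uP t tT.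
    have bL : Linf Om (b s \- b t).
      by apply: LinfB => //; apply: Vspace_Linf; [case: (bV s sT)|case: (bV t tT)].
    rewrite (Linf_sizeE bL) -EFinM; apply/Linf_norm_leP.
      by rewrite mulr_ge0 ?mulr_ge0// Linf_size_ge0.
    apply: stable => //; first exact: Linf_size_ge0.
    apply: filterS3 Fus Fut (ae_bounded_size bL) => x h1 h2 h3 Ox.
    by rewrite /= h1// h2//; exact: h3.
  - exact: cvg_cst.
  - rewrite -[X in _ --> X](mule0 (2 * N)%:E).
    by apply: cvgeZl => //; exact: bC.
move=> v [vB _ vF] t tT.
have [Vut utB Fut] := uP t tT; have [Vvt vtB] := vB t tT.
apply: ae_bounded0; rewrite -(mulr0 (2 * N)); apply: stable => //.
  exact: ballP.
apply: filterS2 Fut (vF t tT) => x h1 h2 Ox.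
by rewrite /= h1// -h2// subrr enorm0.
Unshelve. all: by end_near. Qed.
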